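(* In each of the four categories (closed framed, closed unframed, long framed, long unframed) of virtual knots, the glueing invariant $G$ is stronger than the smoothing invariant $S$. That is: for all virtual knots $K,K'$ in the category, $G(K)=G(K')$ implies $S(K)=S(K')$; and there exist virtual knots $K_1,K_2$ in the category with $S(K_1)=S(K_2)$ but $G(K_1)\neq G(K_2)$.
   Context: A closed (respectively long) virtual knot diagram is a generic immersion of an oriented circle in the plane (respectively an immersion $\mathbb{R}\to\mathbb{R}^2$ coinciding with the $x$-axis outside some closed ball centered at the origin) whose double points are decorated either as classical crossings (with over/under information, hence a sign $\pm1$) or as virtual crossings. Unframed (closed or long) virtual knots are diagrams modulo the classical Reidemeister moves 1, 2, 3, the purely virtual Reidemeister moves 1, 2, 3, and the mixed move (sliding an arc carrying only virtual crossings past a classical crossing). In the framed categories, classical Reidemeister move 1 is replaced by the framed Reidemeister move 1, which inserts or removes on an arc two consecutive kinks whose classical crossings have opposite signs. Virtual links with two components, and two-component virtual tangles with one long and one closed component, are defined in the same way. The flat equivalence class $[\cdot]$ of a knot, link or tangle is its class modulo the moves of the category together with crossing changes at classical crossings. Singular virtual knots may also have transverse double points; they are taken modulo the moves of the category (the classical Reidemeister moves 2, 3, the purely virtual Reidemeister moves 1, 2, 3, the mixed move, and either the classical Reidemeister move 1 in the unframed categories or the framed Reidemeister move 1 in the framed categories) and rigid vertex isotopy (an arc may be slid over, under, or virtually across a double point, and a double point followed by a classical crossing of the same two strands may be replaced by that classical crossing followed by the double point). The flat equivalence class of a singular knot is its class when crossing changes at classical crossings are also allowed (double points are kept). For a diagram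 $K$ and a classical crossing $d$: $K^d_{sm}$ is the result of smoothing $d$ according to orientation (an unordered two-component virtual link in the closed case, a two-component virtual tangle with one long and one closed component in the long case); $K^d_{glue}$ is the singular knot obtained by replacing $d$ by a double point; $[K^0_{link}]$ is the flat class of the union of $K$ with an unlinked copy of the unknot; $[K^0_{sing}]$ is the flat class of the singular knot obtained from $K$ by introducing a kink by a Reidemeister 1 move and replacing its crossing by a double point. Summing over all classical crossings $d$ of $K$, $$S(K)=\sum_d \mathrm{sgn}(d)\bigl([K^d_{sm}]-[K^0_{link}]\bigr),\qquad G(K)=\sum_d \mathrm{sgn}(d)\bigl([K^d_{glue}]-[K^0_{sing}]\bigr)$$ in the unframed cases, and $$S(K)=\sum_d \mathrm{sgn}(d)[K^d_{sm}],\qquad G(K)=\sum_d \mathrm{sgn}(d)[K^d_{glue}]$$ in the framed cases. $S$ and $G$ take values in the free abelian groups generated by, respectively, flat classes of two-component links (closed case) or tangles (long case), and flat classes of singular knots with exactly one double point. They are invariants of virtual knots in the respective category. *)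

(* Defs.v *)
From HB Require Import structures.
From Stdlib Require Import Relation_Operators.
From mathcomp Require Import all_boot all_order all_algebra generic_quotient.
From mathcomp Require Import boolp.
From mathcomp Require Import freeg.

Set Implicit Arguments.
Unset Strict Implicit.
Unset Printing Implicit Defensive.

Import GRing.Theory.
Local Open Scope quotient_scope.

(** * Diagrams

   A generic immersed curve in the plane is put in Morse position with respect
   to the height function and cut into horizontal slices, each containing one
   local minimum ([Cup]), one local maximum ([Cap]) or one double point
   ([Xing]).  The diagram is the list of these slices read from bottom to top;
   a slice [(i, x)] has [i] vertical strands to the left of the event [x].
   A horizontal line avoiding the events meets the diagram in a sequence of
   strands, recorded by their orientations from left to right ([true] is
   upwards).  Planar isotopy is part of the moves below.

   Long diagrams are drawn along the vertical axis, oriented upwards. *)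

(* [Classical e]: the strand going from bottom left to top right is over the
   other one iff [e]. *)
Inductive crossing := Classical of bool | Virtual | Double.

(* [Cup o]: the left leg of the minimum has orientation [o], the right leg the
   opposite one. *)
Inductive event := Cup of bool | Cap | Xing of crossing.

Definition crossing_code (k : crossing) : bool + bool :=
  match k with
  | Classical e => inl e | Virtual => inr true | Double => inr false
  end.

Definition crossing_decode (c : bool + bool) : crossing :=
  match c with inl e => Classical e | inr b => if b then Virtual else Double end.

Lemma crossing_codeK : cancel crossing_code crossing_decode.
Proof. by case. Qed.

HB.instance Definition _ := Choice.copy crossing (can_type crossing_codeK).

Definition event_code (x : event) : option bool + crossing :=
  match x with Cup o => inl (Some o) | Cap => inl None | Xing k => inr k end.

Definition event_decode (c : option bool + crossing) : event :=
  match c with inl (Some o) => Cup o | inl None => Cap | inr k => Xing k end.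

Lemma event_codeK : cancel event_code event_decode.
Proof. by case. Qed.

HB.instance Definition _ := Choice.copy event (can_type event_codeK).

Definition slice := (nat * event)%type.
Definition word := seq slice.

Definition cup i o : slice := (i, Cup o).
Definition cap i : slice := (i, Cap).
Definition xing i k : slice := (i, Xing k).

(* Orientations of the strands above a slice, given those below it; [None] if
   the slice does not fit there. *)
Definition step (s : seq bool) (t : slice) : option (seq bool) :=
  let: (i, x) := t in
  match x with
  | Cup o =>
      if i <= size s then Some (take i s ++ [:: o; ~~ o] ++ drop i s) else None
  | Cap =>
      if drop i s is a :: b :: q then
        if a == ~~ b then Some (take i s ++ q) else None
      else None
  | Xing _ =>
      if drop i s is a :: b :: q then Some (take i s ++ b :: a :: q) else None
  end.

Fixpoint run (s : seq bool) (w : word) : option (seq bool) :=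
  if w is t :: w' then obind (run^~ w') (step s t) else Some s.

Definition ends (long : bool) : seq bool := if long then [:: true] else [::].

Definition well_formed (long : bool) (w : word) : bool :=
  run (ends long) w == Some (ends long).

(* Any number of components: oriented virtual links, or tangles with one long
   component when [long] holds, possibly with double points. *)
Definition diagram (long : bool) := {w : word | well_formed long w}.

(* Number of closed components.  [lab] labels the strands at the current height
   so that two strands have the same label iff they are connected below that
   height; [n] is a fresh label.  A cap joining two strands with the same label
   closes a component, otherwise it merges the two labels. *)
Fixpoint closed_components (lab : seq nat) (n : nat) (w : word) : nat :=
  match w with
  | [::] => 0
  | (i, Cup _) :: w' =>
      closed_components (take i lab ++ [:: n; n] ++ drop i lab) n.+1 w'
  | (i, Cap) :: w' =>
      let a := nth 0 lab i in
      let b := nth 0 lab i.+1 in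
      (a == b) + closed_components
        [seq if x == b then a else x | x <- take i lab ++ drop i.+2 lab] n w'
  | (i, Xing _) :: w' =>
      closed_components
        (take i lab ++ [:: nth 0 lab i.+1; nth 0 lab i] ++ drop i.+2 lab) n w'
  end.

Definition num_closed_components (long : bool) (w : word) : nat :=
  let n := size (ends long) in closed_components (iota 0 n) n w.

Definition has_double (w : word) : bool :=
  has [pred t : slice | t.2 == Xing Double] w.

(* A diagram of a virtual knot; [G] and [S] below are computed on diagrams, and
   do not depend on the diagram chosen to represent a virtual knot. *)
Record vknot (long : bool) := VKnot {
  vknot_diagram :> diagram long;
  vknot_connected :
    num_closed_components long (val vknot_diagram) = if long then 0 else 1;
  vknot_nonsingular : ~~ has_double (val vknot_diagram)
}.

(** * Moves *)

(* The same crossing with the roles of its two strands exchanged: the strand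
   from bottom left to top right is over iff the other one was. *)
Definition flip (k : crossing) : crossing :=
  if k is Classical e then Classical (~~ e) else k.

Definition bottom_strands (x : event) : nat := if x is Cup _ then 0 else 2.
Definition top_strands (x : event) : nat := if x is Cap then 0 else 2.

(* Moves of generic plane curves under isotopy: exchange of the heights of two
   horizontally disjoint events, birth or death of a minimum-maximum pair, and
   passage of a maximum or of a minimum through a double point. *)
Inductive planar_isotopy : word -> word -> Prop :=
| Exchange x y g :
    planar_isotopy [:: (0, x); (top_strands x + g, y)]
                   [:: (bottom_strands x + g, y); (0, x)]
| Zigzag_right o : planar_isotopy [:: cup 1 o; cap 0] [::]
| Zigzag_left o : planar_isotopy [:: cup 0 o; cap 1] [::]
| Pass_max k :
    planar_isotopy [:: xing 0 k; cap 1] [:: xing 1 (flip k); cap 0]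
| Pass_min o k :
    planar_isotopy [:: cup 1 o; xing 0 k] [:: cup 0 o; xing 1 (flip k)].

(* A kink on a vertical strand of orientation [o], with loop on its right or on
   its left; the sign of a classical kink crossing [Classical e] is positive
   iff [e]. *)
Definition kink (right : bool) (o : bool) (k : crossing) : word :=
  if right then [:: cup 1 o; xing 0 k; cap 1]
  else [:: cup 0 (~~ o); xing 1 k; cap 0].

(* Whether an arc meeting the two other strands of a triangle in crossings of
   type [m] may be slid across their crossing [k].  An over or under arc
   ([m] classical) passes a classical crossing (third Reidemeister move) or a
   double point (rigid vertex isotopy), but not a virtual one; a virtual arc
   passes everything. *)
Definition slides (m k : crossing) : bool :=
  match m with
  | Classical _ => k != Virtual
  | Virtual => true
  | Double => false
  end.

(* [move framed s l r]: the local picture [l], whose bottom strands have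
   orientations [s], may be replaced by [r].  Moves not mentioning [s] hold for
   all orientations. *)
Inductive move (framed : bool) (s : seq bool) : word -> word -> Prop :=
| Isotopy l r : planar_isotopy l r -> move framed s l r
| R1 right o e : ~~ framed ->
    move framed s (kink right o (Classical e)) [::]
| R1_framed right right' o e : framed ->
    move framed s (kink right o (Classical e) ++
                   kink right' o (Classical (~~ e))) [::]
| R1_virtual right o : move framed s (kink right o Virtual) [::]
| R2 m : m != Double -> move framed s [:: xing 0 m; xing 0 (flip m)] [::]
(* Of three strands numbered from left to right at the bottom, the sliding arc
   is the first, the second or the third one; when [m] is [Classical e], it is
   over the two other strands iff [e]. *)
| Slide1 m k : slides m k ->
    move framed s [:: xing 0 m; xing 1 m; xing 0 k]
                  [:: xing 1 k; xing 0 m; xing 1 m]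
| Slide2 m k : slides m k ->
    move framed s [:: xing 0 (flip m); xing 1 k; xing 0 m]
                  [:: xing 1 m; xing 0 k; xing 1 (flip m)]
| Slide3 m k : slides m k ->
    move framed s [:: xing 0 k; xing 1 (flip m); xing 0 (flip m)]
                  [:: xing 1 (flip m); xing 0 (flip m); xing 1 k]
(* Both strands traverse the double point and then the crossing (or
   conversely), hence they are parallel. *)
| Vertex_twist o e : s = [:: o; o] ->
    move framed s [:: xing 0 Double; xing 0 (Classical e)]
                  [:: xing 0 (Classical e); xing 0 Double].

Inductive flat_move (framed : bool) (s : seq bool) : word -> word -> Prop :=
| Category_move l r : move framed s l r -> flat_move framed s l r
| Crossing_change e :
    flat_move framed s [:: xing 0 (Classical e)] [:: xing 0 (Classical (~~ e))].

Definition shift (i : nat) (w : word) : word := [seq (i + t.1, t.2) | t <- w].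

(* Replacement, inside a diagram, of the local picture [l] by [r], with the same
   oriented end points; [u] and [v] are below and above it, [p] and [q] are the
   strands on its left and on its right. *)
Inductive flat_step (framed long : bool) (D D' : diagram long) : Prop :=
| FlatStep u v p q s s' l r :
    run (ends long) u = Some (p ++ s ++ q) ->
    run s l = Some s' -> run s r = Some s' ->
    flat_move framed s l r ->
    val D = u ++ shift (size p) l ++ v ->
    val D' = u ++ shift (size p) r ++ v ->
    flat_step framed D D'.

Definition flat_equiv (framed long : bool) : diagram long -> diagram long -> Prop :=
  clos_refl_sym_trans _ (@flat_step framed long).

Definition flat_eqb (framed long : bool) : rel (diagram long) :=
  fun D D' => `[< flat_equiv framed D D' >].

Lemma flat_eqb_refl framed long : reflexive (@flat_eqb framed long).
Proof. by move=> D; apply/asboolP/rst_refl. Qed.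

Lemma flat_eqb_sym framed long : symmetric (@flat_eqb framed long).
Proof.
by move=> D D'; apply/idP/idP => /asboolP H; apply/asboolP/rst_sym.
Qed.

Lemma flat_eqb_trans framed long : transitive (@flat_eqb framed long).
Proof.
by move=> D2 D1 D3 /asboolP H /asboolP H'; apply/asboolP; apply: rst_trans H H'.
Qed.

Canonical flat_eqb_equiv framed long := EquivRel (@flat_eqb framed long)
  (@flat_eqb_refl framed long) (@flat_eqb_sym framed long)
  (@flat_eqb_trans framed long).

Definition flat_class (framed long : bool) := {eq_quot (@flat_eqb framed long)}.
HB.instance Definition _ framed long := Choice.on (flat_class framed long).
HB.instance Definition _ framed long := Quotient.on (flat_class framed long).
HB.instance Definition _ framed long :
  EqQuotient _ (@flat_eqb framed long) (flat_class framed long) :=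
  EqQuotient.on (flat_class framed long).

Definition flat (framed long : bool) (D : diagram long) : flat_class framed long :=
  (\pi_(flat_class framed long) D)%qT.

(** * Operations on diagrams *)

Definition slice_at (w : word) (d : nat) : slice := nth (cap 0) w d.

Definition is_classical (w : word) (d : nat) : bool :=
  if (slice_at w d).2 is Xing (Classical _) then true else false.

(* Orientations of the left and right strands just below slice [d]. *)
Definition strands_at (long : bool) (w : word) (d : nat) : bool * bool :=
  let s := odflt [::] (run (ends long) (take d w)) in
  let i := (slice_at w d).1 in
  (nth true s i, nth true s i.+1).

(* A crossing of two upward strands is positive iff its over strand goes from
   bottom left to top right; reversing one strand changes the sign. *)
Definition sgn (long : bool) (w : word) (d : nat) : int :=
  if (slice_at w d).2 is Xing (Classical e) then
    let: (a, b) := strands_at long w d in if e == (a == b) then 1%R else (-1)%R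
  else 0%R.

Definition replace (w : word) (d : nat) (r : word) : word :=
  take d w ++ r ++ drop d.+1 w.

(* Two parallel strands are smoothed vertically, two antiparallel ones
   horizontally. *)
Definition smooth_word (long : bool) (w : word) (d : nat) : word :=
  let i := (slice_at w d).1 in
  let: (a, b) := strands_at long w d in
  replace w d (if a == b then [::] else [:: cap i; cup i b]).

Definition glue_word (w : word) (d : nat) : word :=
  replace w d [:: xing (slice_at w d).1 Double].

Definition union_unknot_word (w : word) : word := w ++ [:: cup 0 true; cap 0].

(* The kink is put on the leftmost strand at the lowest height where there is
   one: at the bottom of a long diagram, above the first minimum of a closed
   one.  Up to unframed flat equivalence, neither its place nor the side of its
   loop matters. *)
Definition singular_kink_word (long : bool) (w : word) : word :=
  let h := if long then 0 else 1 in
  let o := head true (odflt [::] (run (ends long) (take h w))) in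
  take h w ++ kink true o Double ++ drop h w.

Lemma run_cat s u v : run s (u ++ v) = obind (run^~ v) (run s u).
Proof. by elim: u s => //= t u IH s; case: (step s t) => //= s'. Qed.

Lemma step_xing s s' i k : step s (xing i k) = Some s' ->
  exists p a b q, [/\ s = p ++ [:: a, b & q], size p = i
                    & s' = p ++ [:: b, a & q]].
Proof.
rewrite /step /=; case E: (drop i s) => [//|a [//|b q]] [<-].
exists (take i s), a, b, q; split=> //; first by rewrite -E cat_take_drop.
apply: size_takel; rewrite leqNgt; apply/negP => /ltnW /drop_oversize.
by rewrite E.
Qed.

Lemma is_classical_size w d : is_classical w d -> d < size w.
Proof.
by rewrite /is_classical /slice_at; case: ltnP => // le; rewrite nth_default.
Qed.

Lemma well_formed_replace long w d r : is_classical w d ->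
  (forall s s', run (ends long) (take d w) = Some s ->
     step s (slice_at w d) = Some s' -> run s r = Some s') ->
  well_formed long w -> well_formed long (replace w d r).
Proof.
move=> /is_classical_size lt Hr; rewrite /well_formed /replace.
rewrite -{1}(cat_take_drop d w) (drop_nth (cap 0) lt) !run_cat.
case E: (run _ _) => [s|] //=; rewrite run_cat.
case Es: (step s _) => [s'|] //= Hw.
by rewrite (Hr _ _ E Es).
Qed.

Lemma smooth_subproof long (D : diagram long) d : is_classical (val D) d ->
  well_formed long (smooth_word long (val D) d).
Proof.
move=> cl; rewrite /smooth_word /strands_at.
move: (cl); rewrite /is_classical; case E: (slice_at _ _) => [i x] /=.
case: x E => [//|//|[e||]] // E _.
apply: well_formed_replace (valP D) => // s s' Es; rewrite E Es.
case/step_xing=> p [a [b [q [-> <- ->]]]].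
rewrite /= !nth_cat ltnn subnn ltnNge leqnSn /= subSnn /=.
case: eqP => [->//|ne] /=.
have -> : a = ~~ b by case: (a) (b) ne => [] [].
rewrite drop_size_cat // eqxx take_size_cat //= size_cat leq_addr /=.
by rewrite take_size_cat // drop_size_cat.
Qed.

Lemma glue_subproof long (D : diagram long) d : is_classical (val D) d ->
  well_formed long (glue_word (val D) d).
Proof.
move=> cl; move: (cl); rewrite /glue_word /is_classical.
case E: (slice_at _ _) => [i x] /=.
case: x E => [//|//|[e||]] // E _.
apply: well_formed_replace (valP D) => // s s' _; rewrite E /=.
by move=> ->.
Qed.

Lemma union_unknot_subproof long (D : diagram long) :
  well_formed long (union_unknot_word (val D)).
Proof. by rewrite /well_formed run_cat (eqP (valP D)); case: long D. Qed.

Lemma singular_kink_subproof long (K : vknot long) :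
  well_formed long (singular_kink_word long (val (vknot_diagram K))).
Proof.
case: K => -[w /= wf] conn _.
case: long wf conn => wf.
  by rewrite /singular_kink_word take0 drop0.
case: w wf => // -[i x] w wf _.
rewrite /singular_kink_word /= take0 drop0.
move: wf; rewrite /well_formed /=.
case: x => [o||k] //=; first by case: i => [|i] //=; case: o.
Qed.

(* [smooth] and [glue] are the identity when [d] is not a classical crossing. *)
Definition smooth (long : bool) (D : diagram long) (d : nat) : diagram long :=
  if boolP (is_classical (val D) d) is AltTrue cl
  then Sub (smooth_word long (val D) d) (smooth_subproof cl) else D.

Definition glue (long : bool) (D : diagram long) (d : nat) : diagram long :=
  if boolP (is_classical (val D) d) is AltTrue cl
  then Sub (glue_word (val D) d) (glue_subproof cl) else D.

Definition union_unknot (long : bool) (D : diagram long) : diagram long :=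
  Sub (union_unknot_word (val D)) (union_unknot_subproof D).

Definition singular_kink (long : bool) (K : vknot long) : diagram long :=
  Sub (singular_kink_word long (val (vknot_diagram K)))
      (singular_kink_subproof K).

(** * The invariants

   Classes of links (or tangles) with any number of components and double
   points serve as basis; the free abelian groups of the definitions are
   subgroups spanned by parts of this basis. *)

Local Open Scope ring_scope.

Definition smoothing_invariant (framed long : bool) (K : vknot long) :
    {freeg (flat_class framed long)} :=
  \sum_(d < size (val (vknot_diagram K)) | is_classical (val (vknot_diagram K)) d)
    (<< flat framed (smooth K d) >>
     - (if framed then 0 else << flat framed (union_unknot K) >>))
    *~ sgn long (val (vknot_diagram K)) d.

Definition glueing_invariant (framed long : bool) (K : vknot long) :
    {freeg (flat_class framed long)} :=
  \sum_(d < size (val (vknot_diagram K)) | is_classical (val (vknot_diagram K)) d)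
    (<< flat framed (glue K d) >>
     - (if framed then 0 else << flat framed (singular_kink K) >>))
    *~ sgn long (val (vknot_diagram K)) d.

(* Main.v *)
(* Smoothing every double point according to orientation is compatible with all
   flat moves.  It sends K^d_glue to K^d_sm, and the singular kink to a split
   circle, so the induced additive map takes G(K) to S(K); this gives the first
   half.

   For the second half, take a long knot with four classical crossings 1, 3, 6, 8
   (or its closure), and change the crossings 1 and 8, which have opposite signs.
   Their smoothings are flat equivalent by an explicit sequence of moves, so that
   their contributions to S cancel before and after the change.  Their glueings
   are distinguished as follows.  A double point splits the knot K into two lobes
   X and Y; smoothing a flat crossing c cuts off a loop L, with intersection
   numbers L.K and L.X on the surface carrying K.  If X.Y = 2 or -2, the number of
   crossings with L.K = 2 or -2 and L.X odd, counted with the sign of L.K, does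
   not change under the moves: the exchange of the double point with a crossing c
   of the same strands only affects c, whose loop L is a lobe, so that L.X is
   even. *)

From HB Require Import structures.
Require Import Defs.
From Stdlib Require Import Relation_Operators.
From mathcomp Require Import all_boot all_order all_algebra generic_quotient.
From mathcomp Require Import boolp freeg zify.

Set Implicit Arguments.
Unset Strict Implicit.
Unset Printing Implicit Defensive.

Import GRing.Theory.

(** * Moves on words with arbitrary boundary, and their contexts *)

Lemma shift_cat n u v : shift n (u ++ v) = shift n u ++ shift n v.
Proof. exact: map_cat. Qed.

Lemma shift_shift m n w : shift m (shift n w) = shift (m + n) w.
Proof. by rewrite /shift -map_comp; apply: eq_map => t /=; rewrite addnA. Qed.

Lemma shift0 w : shift 0 w = w.
Proof. by elim: w => //= -[i x] w ->. Qed.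

Lemma step_shift p s q i x s' : step s (i, x) = Some s' ->
  step (p ++ s ++ q) (size p + i, x) = Some (p ++ s' ++ q).
Proof.
have dropE: i <= size s -> drop (size p + i) (p ++ s ++ q) = drop i s ++ q.
  move=> le; rewrite addnC -drop_drop drop_size_cat // drop_cat.
  by case: ltngtP le => // -> _; rewrite subnn drop0 drop_size.
have takeE: i <= size s -> take (size p + i) (p ++ s ++ q) = p ++ take i s.
  by move=> le; rewrite takeD take_size_cat // drop_size_cat // takel_cat.
have ltn_drop a b t : drop i s = [:: a, b & t] -> i <= size s.
  by move=> E; rewrite leqNgt; apply/negP => /ltnW/drop_oversize; rewrite E.
case: x => [o||k] /=.
- case: leqP => // le [<-]; rewrite !size_cat leq_add2l (leq_trans le) ?leq_addr //.
  by rewrite takeE // dropE // -!catA.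
- case E: (drop i s) => [//|a [//|b t]]; case: eqP => // eab [<-].
  by rewrite dropE ?(ltn_drop _ _ _ E) // E /= eab eqxx takeE ?(ltn_drop _ _ _ E) // -!catA.
- case E: (drop i s) => [//|a [//|b t]] [<-].
  by rewrite dropE ?(ltn_drop _ _ _ E) // E /= takeE ?(ltn_drop _ _ _ E) // -!catA.
Qed.

Lemma run_cons s t w : run s (t :: w) = obind (run^~ w) (step s t).
Proof. by []. Qed.

Lemma run_shift p s q l s' : run s l = Some s' ->
  run (p ++ s ++ q) (shift (size p) l) = Some (p ++ s' ++ q).
Proof.
elim: l s => [|[i x] l IH] s; first by case=> ->.
rewrite run_cons; case E: (step s (i, x)) => [t|] // Hl.
by rewrite [shift _ _]/= run_cons (step_shift p q E); apply: IH.
Qed.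

(** [flat_step] freed from diagrams: the word starts on any strands [st] and need not return to
    them, so that local pictures can be compared before being placed in a diagram. *)
Inductive wstep (framed : bool) (st : seq bool) (w w' : word) : Prop :=
| WStep u v p q s s' l r :
    run st u = Some (p ++ s ++ q) ->
    run s l = Some s' -> run s r = Some s' ->
    flat_move framed s l r ->
    w = u ++ shift (size p) l ++ v ->
    w' = u ++ shift (size p) r ++ v ->
    wstep framed st w w'.

Definition wequiv (framed : bool) (st : seq bool) : word -> word -> Prop :=
  clos_refl_sym_trans _ (wstep framed st).

Lemma wequiv_refl framed st w : wequiv framed st w w.
Proof. exact: rst_refl. Qed.

Lemma wequiv_sym framed st w w' : wequiv framed st w w' -> wequiv framed st w' w.
Proof. exact: rst_sym. Qed.

Lemma wequiv_trans framed st w w' w'' :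
  wequiv framed st w w' -> wequiv framed st w' w'' -> wequiv framed st w w''.
Proof. exact: rst_trans. Qed.

Lemma wstep_run framed st w w' : wstep framed st w w' -> run st w = run st w'.
Proof.
case=> u v p q s s' l r Eu El Er _ -> ->.
by rewrite !run_cat Eu /= !run_cat (run_shift _ _ El) (run_shift _ _ Er).
Qed.

Lemma wequiv_run framed st w w' : wequiv framed st w w' -> run st w = run st w'.
Proof. by elim=> {w w'} [w w' /wstep_run||w w' _ ->|w1 w2 w3 _ -> _ ->]. Qed.

(** A step preserves [run], so every intermediate word of the chain is again a diagram. *)
Lemma wequiv_flat framed long (D D' : diagram long) :
  wequiv framed (ends long) (val D) (val D') -> flat_equiv framed D D'.
Proof.
case: D D' => [w wf] [w' wf'] /= E.
elim: E wf wf' => {w w'} [w w' st|w|w w' _ IH|w1 w2 w3 E1 IH1 _ IH2] wf wf'.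
- apply: rst_step; case: st => u v p q s s' l r Eu El Er m Ew Ew'.
  exact: (@FlatStep _ _ (exist _ w wf) (exist _ w' wf') u v p q s s' l r).
- by rewrite (bool_irrelevance wf wf'); apply: rst_refl.
- by apply: rst_sym; apply: IH.
- have wf2 : well_formed long w2 by rewrite /well_formed -(wequiv_run E1).
  by apply: rst_trans (IH1 wf wf2) (IH2 wf2 wf').
Qed.

Lemma flat_wequiv framed long (D D' : diagram long) :
  flat_equiv framed D D' -> wequiv framed (ends long) (val D) (val D').
Proof.
elim=> [{}D {}D' [u v p q s s' l r Eu El Er m Ew Ew']|{}D|{}D {}D' _|{}D {}D' D'' _ + _].
- by apply: rst_step; apply: (@WStep _ _ _ _ u v p q s s' l r).
- exact: rst_refl.
- exact: rst_sym.
- exact: rst_trans.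
Qed.

Lemma flat_eqP framed long (D D' : diagram long) :
  flat framed D = flat framed D' <-> flat_equiv framed D D'.
Proof.
rewrite /flat; split=> [/eqP|H]; first by rewrite eqmodE => /asboolP.
by apply/eqP; rewrite eqmodE; apply/asboolP.
Qed.

Lemma wequiv_ctx framed st st0 u v p q w w' :
  run st0 u = Some (p ++ st ++ q) -> wequiv framed st w w' ->
  wequiv framed st0 (u ++ shift (size p) w ++ v) (u ++ shift (size p) w' ++ v).
Proof.
move=> Eu; elim=> {w w'} [w w'|w|w w' _|w1 w2 w3 _ + _].
- case=> u' v' p' q' s s' l r Eu' El Er m -> ->; apply: rst_step.
  have Euu : run st0 (u ++ shift (size p) u') = Some ((p ++ p') ++ s ++ (q' ++ q)).
    by rewrite run_cat Eu /= (run_shift _ _ Eu') -!catA.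
  apply: (WStep (v := shift (size p) v' ++ v) Euu El Er m);
    by rewrite !shift_cat shift_shift size_cat -!catA.
- exact: rst_refl.
- exact: rst_sym.
- exact: rst_trans.
Qed.

Lemma wequiv_cat framed st u v w w' st' :
  run st u = Some st' -> wequiv framed st' w w' ->
  wequiv framed st (u ++ w ++ v) (u ++ w' ++ v).
Proof.
move=> Eu E; have Eu' : run st u = Some ([::] ++ st' ++ [::]) by rewrite cats0.
by have := wequiv_ctx v Eu' E; rewrite /= !shift0.
Qed.

Lemma wequiv_move framed s s' l r : flat_move framed s l r ->
  run s l = Some s' -> run s r = Some s' -> wequiv framed s l r.
Proof.
move=> m El Er; apply: rst_step.
apply: (@WStep framed s l r [::] [::] [::] [::] s s' l r) => //=;
  by rewrite ?cats0 ?shift0.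
Qed.

(** * Flat shadows *)

Definition shadow_crossing (k : crossing) : crossing :=
  if k is Classical _ then Classical true else k.

Definition shadow_event (x : event) : event :=
  if x is Xing k then Xing (shadow_crossing k) else x.

Definition shadow (w : word) : word := [seq (t.1, shadow_event t.2) | t <- w].

Lemma run_shadow s w : run s (shadow w) = run s w.
Proof.
elim: w s => // -[i x] w IH s; rewrite [shadow _]/= !run_cons.
have -> : step s (i, shadow_event x) = step s (i, x) by case: x => [||[]].
by case: step => /=.
Qed.

(** Crossing changes make all classical crossings alike, one slice at a time, so flat classes only
    depend on shadows. *)
Lemma shadow_equiv framed s w s' : run s w = Some s' -> wequiv framed s w (shadow w).
Proof.
elim: w s => [|[i x] w IH] s; first by move=> _; apply: wequiv_refl.
rewrite run_cons; case E: (step s (i, x)) => [t|] // Et.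
apply: (@wequiv_trans _ _ _ ((i, x) :: shadow w)).
  have Ex : run s [:: (i, x)] = Some t by rewrite run_cons E.
  have := wequiv_cat [::] Ex (IH _ Et).
  by rewrite !cats0.
rewrite [shadow (_ :: _)]/=.
have [->|] := eqVneq (shadow_event x) x; first exact: wequiv_refl.
move=> ne; case: x E ne => [o||[e||]] E; rewrite /= ?eqxx //.
case: e E => E; rewrite ?eqxx // => _.
have [p [a [b [q [Es Ei _]]]]] := step_xing E.
have Eu : run s [::] = Some (p ++ (a :: b :: q) ++ [::]) by rewrite cats0 /= Es.
have := @wequiv_ctx framed (a :: b :: q) s [::] (shadow w) p [::]
  [:: xing 0 (Classical false)] [:: xing 0 (Classical true)] Eu.
rewrite /= addn0 Ei; apply.
apply: (wequiv_move (Crossing_change _ _ false)) => /=; rewrite ?take0 ?drop0 //.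
Qed.

Lemma wequiv_shadow framed s w w' s' : run s w = Some s' -> shadow w = shadow w' ->
  wequiv framed s w w'.
Proof.
move=> E Ew; apply: wequiv_trans (shadow_equiv framed E) _; rewrite Ew.
by apply: wequiv_sym; apply: (@shadow_equiv _ _ _ s'); rewrite -run_shadow -Ew run_shadow.
Qed.

(** * Certified sequences of moves *)

(** Without framing both kinks can be removed. With framing a pair of opposite left kinks is
    inserted above the right kink, which then cancels with the lower of the two. *)
Lemma kink_flip framed o :
  wequiv framed [:: o] (kink true o (Classical true)) (kink false o (Classical true)).
Proof.
have Ek r e : run [:: o] (kink r o (Classical e)) = Some [:: o] by case: r o => [] [].
case E: framed; last first.
  apply: (@wequiv_trans _ _ _ [::]); last apply: wequiv_sym;
    apply: wequiv_move (Ek _ _) _ => //; exact/Category_move/R1.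
have rem r r' e : wequiv true [:: o]
    (kink r o (Classical e) ++ kink r' o (Classical (~~ e))) [::].
  apply: wequiv_move; first exact/Category_move/R1_framed.
    by rewrite run_cat Ek /= Ek.
  by [].
apply: (@wequiv_trans _ _ _ (kink true o (Classical true) ++
  (kink false o (Classical false) ++ kink false o (Classical true)) ++ [::])).
  have := wequiv_cat [::] (Ek true true) (wequiv_sym (rem false false false)).
  by rewrite !cats0.
rewrite cats0 catA.
have E0 : run [:: o] [::] = Some [:: o] by [].
exact: (wequiv_cat (kink false o (Classical true)) E0 (rem true false true)).
Qed.

(** Moves as data, so that a sequence of them can be checked by computation. Only moves available
    with and without framing are listed; [Flip_kink] stands in for the first Reidemeister move. *)
Inductive rule :=
| Swap_heights of event & event & nat
| Unzig of bool & bool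
| Cross_max of crossing
| Cross_min of bool & crossing
| Unkink of bool & bool
| Cancel of crossing
| Slide_first of crossing & crossing
| Slide_second of crossing & crossing
| Slide_third of crossing & crossing
| Flip_kink of bool.

Definition rule_sides (h : rule) : word * word :=
  match h with
  | Swap_heights x y g =>
      ([:: (0, x); (top_strands x + g, y)], [:: (bottom_strands x + g, y); (0, x)])
  | Unzig b o => (if b then [:: cup 1 o; cap 0] else [:: cup 0 o; cap 1], [::])
  | Cross_max k => ([:: xing 0 k; cap 1], [:: xing 1 (flip k); cap 0])
  | Cross_min o k => ([:: cup 1 o; xing 0 k], [:: cup 0 o; xing 1 (flip k)])
  | Unkink b o => (kink b o Virtual, [::])
  | Cancel m => ([:: xing 0 m; xing 0 (flip m)], [::])
  | Slide_first m k =>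
      ([:: xing 0 m; xing 1 m; xing 0 k], [:: xing 1 k; xing 0 m; xing 1 m])
  | Slide_second m k =>
      ([:: xing 0 (flip m); xing 1 k; xing 0 m], [:: xing 1 m; xing 0 k; xing 1 (flip m)])
  | Slide_third m k =>
      ([:: xing 0 k; xing 1 (flip m); xing 0 (flip m)],
       [:: xing 1 (flip m); xing 0 (flip m); xing 1 k])
  | Flip_kink o => (kink true o (Classical true), kink false o (Classical true))
  end.

Definition rule_valid (h : rule) : bool :=
  match h with
  | Cancel m => m != Double
  | Slide_first m k | Slide_second m k | Slide_third m k => slides m k
  | _ => true
  end.

Lemma rule_equiv framed h s s' : rule_valid h ->
  run s (rule_sides h).1 = Some s' -> run s (rule_sides h).2 = Some s' ->
  wequiv framed s (rule_sides h).1 (rule_sides h).2.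
Proof.
case: h => [x y g|[] o|k|o k|r o|m|m k|m k|m k|o] ok; last first.
  case: s {ok} => [//|a s].
  rewrite (_ : (rule_sides _).1 = shift 0 (kink true o (Classical true)) ++ [::]);
    last by rewrite shift0 cats0.
  rewrite (_ : (rule_sides _).2 = shift 0 (kink false o (Classical true)) ++ [::]);
    last by rewrite shift0 cats0.
  have [<- _ _|] := eqVneq o a.
    have Eu : run (o :: s) [::] = Some ([::] ++ [:: o] ++ s) by [].
    exact: (wequiv_ctx [::] Eu (kink_flip framed o)).
  by case: o a => [] [].
all: move=> El Er; apply: wequiv_move El Er; apply: Category_move.
all: by [exact/Isotopy/Exchange|exact/Isotopy/Zigzag_right|exact/Isotopy/Zigzag_left
        |exact/Isotopy/Pass_max|exact/Isotopy/Pass_min|exact: R1_virtual|exact: R2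
        |exact: Slide1|exact: Slide2|exact: Slide3].
Qed.

(* Crossing changes are free: words are compared up to their shadows. *)
Definition rewrite_at (st : seq bool) (w : word) (n i : nat) (l r : word) :
    option word :=
  let u := take n w in
  let v := drop (n + size l) w in
  if run st u is Some t then
    if (i <= size t) && (shadow w == shadow (u ++ shift i l ++ v)) then
      if (run (drop i t) l, run (drop i t) r) is (Some s, Some s') then
        if s == s' then Some (u ++ shift i r ++ v) else None
      else None
    else None
  else None.

Lemma rewrite_at_equiv framed st w n i l r w' s0 :
  (forall s s', run s l = Some s' -> run s r = Some s' -> wequiv framed s l r) ->
  run st w = Some s0 -> rewrite_at st w n i l r = Some w' -> wequiv framed st w w'.
Proof.
move=> H Ew; rewrite /rewrite_at; case Eu: (run _ _) => [t|] //.
case: ifP => // /andP[le /eqP Es].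
case El: (run _ l) => [s|] //; case Er: (run _ r) => [s'|] //.
case: eqP => // ess [<-]; rewrite -ess in Er.
apply: wequiv_trans (wequiv_shadow framed Ew Es) _.
have Et : run st (take n w) = Some (take i t ++ drop i t ++ [::]).
  by rewrite cats0 cat_take_drop.
have := wequiv_ctx (drop (n + size l) w) Et (H _ _ El Er).
by rewrite size_takel.
Qed.

Inductive instruction :=
| Swap of nat
| Forward of nat & nat & rule
| Backward of nat & nat & rule.

Definition execute (st : seq bool) (w : word) (c : instruction) : option word :=
  let go n i h := if rule_valid h then
    rewrite_at st w n i (rule_sides h).1 (rule_sides h).2 else None in
  let back n i h := if rule_valid h then
    rewrite_at st w n i (rule_sides h).2 (rule_sides h).1 else None in
  match c with
  | Swap n =>
      let: (i, x) := nth (cap 0) w n in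
      let: (j, y) := nth (cap 0) w n.+1 in
      (* The relative position of the two events decides which side of [Exchange] is present. If
         they overlap horizontally, the truncated gap yields a different word and [rewrite_at]
         rejects it. *)
      if i + top_strands x <= j then go n i (Swap_heights x y (j - i - top_strands x))
      else back n j (Swap_heights y x (i - j - bottom_strands y))
  | Forward n i h => go n i h
  | Backward n i h => back n i h
  end.

Lemma execute_equiv framed st w c w' s : run st w = Some s ->
  execute st w c = Some w' -> wequiv framed st w w'.
Proof.
move=> Ew; have go n i h : (if rule_valid h then
    rewrite_at st w n i (rule_sides h).1 (rule_sides h).2 else None) = Some w' ->
    wequiv framed st w w'.
  by case: ifP => // ok; apply: rewrite_at_equiv Ew => {}s s'; apply: rule_equiv.
have back n i h : (if rule_valid h then
    rewrite_at st w n i (rule_sides h).2 (rule_sides h).1 else None) = Some w' ->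
    wequiv framed st w w'.
  case: ifP => // ok; apply: rewrite_at_equiv Ew => {}s s' Er El.
  by apply: wequiv_sym; apply: rule_equiv El Er.
rewrite /execute; case: c => [n|n i h|n i h]; [|exact: go|exact: back].
case: (nth _ _ n) => i x; case: (nth _ _ _) => j y.
by case: (i + _ <= j);
  [exact: (go _ _ (Swap_heights _ _ _))|exact: (back _ _ (Swap_heights _ _ _))].
Qed.

Definition execute_all (st : seq bool) (w : word) (cs : seq instruction) :
    option word :=
  foldl (fun o c => obind (fun w => execute st w c) o) (Some w) cs.

Lemma execute_all_equiv framed st w cs w' s :
  run st w = Some s -> run st w' = Some s ->
  omap shadow (execute_all st w cs) = Some (shadow w') -> wequiv framed st w w'.
Proof.
move=> Ew Ew' E; apply: wequiv_trans (wequiv_sym (shadow_equiv framed Ew')).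
move: (wequiv_refl framed st w) E; rewrite /execute_all.
elim: cs {2 3}w => [|c cs IH] w1 E1 /=.
  move=> [<-]; apply: (wequiv_trans E1); apply: (@shadow_equiv _ _ _ s).
  by rewrite -(wequiv_run E1).
have Ew1 : run st w1 = Some s by rewrite -(wequiv_run E1).
case E: (execute st w1 c) => [w2|] /=; last by elim: cs {IH}.
exact: (IH _ (wequiv_trans E1 (execute_equiv framed Ew1 E))).
Qed.

#[local] Arguments step : simpl never.

(** * Smoothing all double points *)

Definition smoothing (a b : bool) (x : event) : seq event :=
  if x == Xing Double then if a == b then [::] else [:: Cap; Cup b] else [:: x].

Definition smooth_slice (s : seq bool) (t : slice) : word :=
  [seq (t.1, x) | x <- smoothing (nth true s t.1) (nth true s t.1.+1) t.2].

Fixpoint smooth_all (s : seq bool) (w : word) : word :=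
  if w is t :: w' then
    smooth_slice s t ++ smooth_all (odflt [::] (step s t)) w'
  else [::].

Lemma step_size s i x s' : step s (i, x) = Some s' -> i + bottom_strands x <= size s.
Proof.
have drop2 a b q : drop i s = [:: a, b & q] -> i + 2 <= size s.
  by move=> /(congr1 size); rewrite size_drop /=; lia.
rewrite /step; case: x => [o||k] /=; first by rewrite addn0; case: ifP.
- by case E: (drop i s) => [//|a [//|b q]] _; apply: drop2 E.
- by case E: (drop i s) => [//|a [//|b q]] _; apply: drop2 E.
Qed.

Lemma run_smooth_slice s t s' : step s t = Some s' -> run s (smooth_slice s t) = Some s'.
Proof.
case: t => i x Es; rewrite /smooth_slice /smoothing /=.
case: eqP => [ex|_]; last by rewrite [map _ _]/= run_cons Es.
rewrite {x}ex in Es *; have [p [a [b [q [-> <- ->]]]]] := step_xing Es.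
rewrite !nth_cat ltnn subnn ltnNge leqnSn /= subSnn /=.
case: eqP => [->//|ne] /=.
have -> : a = ~~ b by case: (a) (b) ne => [] [].
rewrite /step /= drop_size_cat // eqxx take_size_cat //= size_cat leq_addr /=.
by rewrite take_size_cat // drop_size_cat.
Qed.

Lemma run_smooth_all s w s' : run s w = Some s' -> run s (smooth_all s w) = Some s'.
Proof.
elim: w s => // t w IH s; rewrite run_cons [smooth_all _ _]/= run_cat.
case Es: (step s t) => [s1|] // Ew.
by rewrite (run_smooth_slice Es); apply: IH.
Qed.

Lemma smooth_all_cat s u v s' : run s u = Some s' ->
  smooth_all s (u ++ v) = smooth_all s u ++ smooth_all s' v.
Proof.
elim: u s => [|t u IH] s; first by case=> ->.
rewrite run_cons /=; case: (step s t) => [s1|] //= Eu.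
by rewrite (IH _ Eu) catA.
Qed.

Lemma smooth_slice_shift p s q i x s' : step s (i, x) = Some s' ->
  smooth_slice (p ++ s ++ q) (size p + i, x) = shift (size p) (smooth_slice s (i, x)).
Proof.
move=> Es; rewrite /smooth_slice /smoothing /=.
case: eqP => [ex|] //; rewrite -addnS; have := step_size Es; rewrite ex /= => le.
have nthE j : j < size s -> nth true (p ++ s ++ q) (size p + j) = nth true s j.
  by move=> lt; rewrite nth_cat ltnNge leq_addr /= addKn nth_cat lt.
by rewrite !nthE; try lia; case: ifP => //=; rewrite addn0.
Qed.

Lemma smooth_all_shift p s q l s' : run s l = Some s' ->
  smooth_all (p ++ s ++ q) (shift (size p) l) = shift (size p) (smooth_all s l).
Proof.
elim: l s => // -[i x] l IH s; rewrite run_cons.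
case Es: (step s (i, x)) => [s1|] // El.
rewrite [shift _ (_ :: _)]/= [LHS]/= -/(step _ (_, x)) (step_shift p q Es) /=.
by rewrite (smooth_slice_shift _ _ Es) (IH _ El) [in RHS]/= Es /= shift_cat.
Qed.

Lemma smooth_all_id s w : ~~ has_double w -> smooth_all s w = w.
Proof.
elim: w s => //= -[i x] w IH s; rewrite negb_or => /andP[/= ne /IH->].
by rewrite /smooth_slice /smoothing (negbTE ne).
Qed.

Lemma wequiv_catr framed s v w w' :
  wequiv framed s w w' -> wequiv framed s (w ++ v) (w' ++ v).
Proof. by move=> E; apply: (@wequiv_cat framed s [::] v _ _ s). Qed.

Lemma wequiv_catl framed s u w w' s' : run s u = Some s' ->
  wequiv framed s' w w' -> wequiv framed s (u ++ w) (u ++ w').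
Proof. by move=> Eu /(wequiv_cat [::] Eu); rewrite !cats0. Qed.

Lemma wequiv_right framed s q w w' :
  wequiv framed s w w' -> wequiv framed (s ++ q) w w'.
Proof.
move=> E; have Eu : run (s ++ q) [::] = Some ([::] ++ s ++ q) by [].
by have := wequiv_ctx [::] Eu E; rewrite /= !cats0 !shift0.
Qed.

Lemma step_cat p s i x :
  step (p ++ s) (size p + i, x) = omap (cat p) (step s (i, x)).
Proof.
have dropE : drop (size p + i) (p ++ s) = drop i s.
  by rewrite addnC -drop_drop drop_size_cat.
have takeE : take (size p + i) (p ++ s) = p ++ take i s.
  by rewrite takeD take_size_cat // drop_size_cat.
rewrite /step; case: x => [o||k] /=; rewrite ?dropE ?takeE ?size_cat ?leq_add2l.
- by case: ifP => //=; rewrite -catA.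
- by case: (drop i s) => [//|a [//|b q]]; case: ifP => //= _; rewrite -catA.
- by case: (drop i s) => [//|a [//|b q]] /=; rewrite -catA.
Qed.

(** * Exchanging the heights of smoothed events *)

Lemma step0_split s x s' : step s (0, x) = Some s' ->
  exists a a' r, [/\ s = a ++ r, s' = a' ++ r, size a = bottom_strands x,
    size a' = top_strands x & step a (0, x) = Some a'].
Proof.
rewrite /step; case: x => [o||k] /=; rewrite ?drop0 ?take0.
- by move=> [<-]; exists [::], [:: o; ~~ o], s.
- case: s => [//|a [//|b q]]; case: eqP => // -> [<-].
  by exists [:: ~~ b; b], [::], q; rewrite /= eqxx.
- by case: s => [//|a [//|b q]] [<-]; exists [:: a; b], [:: b; a], q.
Qed.

Lemma run_cons2 s t u : run s [:: t; u] = obind (step^~ u) (step s t).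
Proof.
by rewrite /=; case: (step s t) => //= s1; case: (step s1 u).
Qed.

Lemma run_exchange s x y g s' :
  run s [:: (0, x); (top_strands x + g, y)] = Some s' ->
  run s [:: (bottom_strands x + g, y); (0, x)] = Some s'.
Proof.
rewrite !run_cons2; case Ex: (step s (0, x)) => [s1|] //.
have [a [a' [r [-> -> <- <- Ea]]]] := step0_split Ex.
rewrite (_ : obind _ (Some _) = step (a' ++ r) (size a' + g, y)) // !step_cat; case: (step r (g, y)) => [r'|] //= [<-].
exact: (step_shift [::] r' Ea).
Qed.

(** Smoothing turns a double point into no event or into a maximum below a minimum. A stack is such
    a block of events at one horizontal position, with [b] strands below and [t] above, which is
    moved as a whole. *)
Fixpoint stack (b : nat) (xs : seq event) (t : nat) : bool :=
  if xs is x :: xs' then (bottom_strands x == b) && stack (top_strands x) xs' t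
  else b == t.

Definition at_height (i : nat) (xs : seq event) : word := [seq (i, x) | x <- xs].

Lemma exchange_below framed s b xs t g y s' : stack b xs t ->
  run s (at_height 0 xs ++ [:: (t + g, y)]) = Some s' ->
  wequiv framed s (at_height 0 xs ++ [:: (t + g, y)])
    ((b + g, y) :: at_height 0 xs).
Proof.
elim: xs b s => [|x xs IH] b s; first by move=> /eqP <- _; apply: wequiv_refl.
move=> /= /andP[/eqP <- H]; rewrite -/(step s (0, x)).
case Es: (step s (0, x)) => [s1|] // E.
have Ex : run s [:: (0, x)] = Some s1 by rewrite run_cons Es.
have E1 := IH _ _ H E.
apply: (wequiv_trans (wequiv_catl Ex E1)).
move: (E : run s1 (at_height 0 xs ++ [:: (t + g, y)]) = Some s').
rewrite (wequiv_run E1).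
have -> : run s1 ((top_strands x + g, y) :: at_height 0 xs) =
    obind (run^~ (at_height 0 xs)) (run s [:: (0, x); (top_strands x + g, y)]).
  by rewrite run_cons run_cons2 Es.
case E2: (run s _) => [s2|] // _.
apply: (@wequiv_catr framed s (at_height 0 xs) [:: (0, x); _] [:: _; (0, x)]).
apply: wequiv_move E2 (run_exchange E2).
exact/Category_move/Isotopy/Exchange.
Qed.

Lemma exchange_stacks framed s b xs t g ys s' : stack b xs t ->
  run s (at_height 0 xs ++ at_height (t + g) ys) = Some s' ->
  wequiv framed s (at_height 0 xs ++ at_height (t + g) ys)
    (at_height (b + g) ys ++ at_height 0 xs).
Proof.
move=> H; elim: ys s => [|y ys IH] s; first by rewrite cats0; move=> _; apply: wequiv_refl.
rewrite [at_height (t + g) _]/= -cat1s catA run_cat.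
case E: (run s (_ ++ _)) => [s1|] // Ey.
have E1 := exchange_below framed H E.
apply: (wequiv_trans (wequiv_catr _ E1)).
have := E; rewrite (wequiv_run E1) -cat1s run_cat.
case E2: (run s [:: _]) => [s2|] // E3.
apply: (wequiv_catl E2); apply: IH.
by rewrite run_cat (E3 : run s2 (at_height 0 xs) = Some s1).
Qed.

Lemma stack_smoothing a b x :
  stack (bottom_strands x) (smoothing a b x) (top_strands x).
Proof.
rewrite /smoothing; case: eqP => [->|_] /=; last by rewrite !eqxx.
by case: ifP.
Qed.

Lemma smooth_all2 s t u s1 s2 : step s t = Some s1 -> step s1 u = Some s2 ->
  smooth_all s [:: t; u] = smooth_slice s t ++ smooth_slice s1 u.
Proof. by move=> /= -> /= _; rewrite cats0. Qed.

(** Each event sees the same orientations in either order, hence is smoothed in the same way; the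
    two resulting stacks then pass each other. *)
Lemma smooth_exchange framed s x y g s' :
  run s [:: (0, x); (top_strands x + g, y)] = Some s' ->
  wequiv framed s (smooth_all s [:: (0, x); (top_strands x + g, y)])
    (smooth_all s [:: (bottom_strands x + g, y); (0, x)]).
Proof.
move=> E; have := run_exchange E; have := E; rewrite !run_cons2.
case Ex: (step s (0, x)) => [s1|] //; case Ey: (step s (_, y)) => [s2|] // Ey' Ex'.
have {}Ey' : step s1 (top_strands x + g, y) = Some s' by [].
have {}Ex' : step s2 (0, x) = Some s' by [].
have Es := run_smooth_all E.
rewrite (smooth_all2 Ex Ey') in Es *; rewrite (smooth_all2 Ey Ex').
have [a [a' [r [es es1 sa sa' Ea]]]] := step0_split Ex.
have e1 : smooth_slice s (bottom_strands x + g, y) =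
    at_height (bottom_strands x + g)
      (smoothing (nth true s1 (top_strands x + g)) (nth true s1 (top_strands x + g).+1) y).
  rewrite /smooth_slice /= es es1 -!addnS -sa -sa' !nth_cat.
  by rewrite !ltnNge !leq_addr /= !addKn.
have e2 : smooth_slice s2 (0, x) =
    at_height 0 (smoothing (nth true s 0) (nth true s 1) x).
  rewrite /smooth_slice /smoothing /=; case: eqP => // ex; rewrite ex /= in sa Ey *.
  move: Ey; rewrite es -sa step_cat; case: (step r _) => [r'|] //= [<-].
  by case: (a) sa => [|? [|? []]].
by rewrite e1 e2; apply: exchange_stacks Es; apply: stack_smoothing.
Qed.

(** * Compatibility of smoothing with the moves *)

Lemma smooth_all_right s q l s' : run s l = Some s' ->
  smooth_all (s ++ q) l = smooth_all s l.
Proof. by move=> E; have := smooth_all_shift [::] q E; rewrite !shift0. Qed.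

Lemma wequiv_plain framed s s' l r : flat_move framed s l r ->
  run s l = Some s' -> run s r = Some s' -> ~~ has_double l -> ~~ has_double r ->
  wequiv framed s (smooth_all s l) (smooth_all s r).
Proof. by move=> m El Er dl dr; rewrite !smooth_all_id //; apply: wequiv_move El Er. Qed.

Ltac by_instructions cs :=
  eapply (@execute_all_equiv _ _ _ cs); [vm_compute; reflexivity..].

Lemma smooth_slide1 framed a b c m : m != Double ->
  wequiv framed [:: a; b; c]
    (smooth_all [:: a; b; c] [:: xing 0 m; xing 1 m; xing 0 Double])
    (smooth_all [:: a; b; c] [:: xing 1 Double; xing 0 m; xing 1 m]).
Proof.
(* For parallel strands the double point disappears and both sides are the same word. For
   antiparallel ones the sliding arc is pulled off the maximum by a second Reidemeister move and
   then pushed across the minimum. *)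
pose cs := if b == c then [::] else [:: Backward 1 0 (Cross_max m);
  Forward 0 0 (Cancel m); Backward 2 1 (Cancel m); Backward 1 0 (Cross_min c m)].
by case: m @cs => [e||] // cs _; case: a b c @cs => [] [] [] cs; by_instructions cs.
Qed.

Lemma smooth_slide2 framed a b c m : m != Double ->
  wequiv framed [:: a; b; c]
    (smooth_all [:: a; b; c] [:: xing 0 (flip m); xing 1 Double; xing 0 m])
    (smooth_all [:: a; b; c] [:: xing 1 m; xing 0 Double; xing 1 (flip m)]).
Proof.
(* Here the sliding arc is the middle strand: between parallel strands it moves from one to the
   other by two second Reidemeister moves, and for antiparallel ones it passes the maximum and the
   minimum. *)
pose cs := if a == c then [:: Forward 0 0 (Cancel m); Backward 0 1 (Cancel m)]
  else [:: Forward 0 0 (Cross_max m); Forward 2 0 (Cross_min c m)].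
by case: m @cs => [[]||] // cs _; case: a b c @cs => [] [] [] cs; by_instructions cs.
Qed.

Lemma smooth_slide3 framed a b c m : m != Double ->
  wequiv framed [:: a; b; c]
    (smooth_all [:: a; b; c] [:: xing 0 Double; xing 1 (flip m); xing 0 (flip m)])
    (smooth_all [:: a; b; c] [:: xing 1 (flip m); xing 0 (flip m); xing 1 Double]).
Proof.
pose cs := if a == b then [::] else [:: Backward 1 0 (Cross_min b m);
  Forward 2 0 (Cancel m); Backward 0 1 (Cancel m); Backward 1 0 (Cross_max m)].
by case: m @cs => [[]||] // cs _; case: a b c @cs => [] [] [] cs; by_instructions cs.
Qed.

Lemma smooth_pass_max framed a b :
  wequiv framed [:: a; b; ~~ a]
    (smooth_all [:: a; b; ~~ a] [:: xing 0 Double; cap 1])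
    (smooth_all [:: a; b; ~~ a] [:: xing 1 Double; cap 0]).
Proof.
pose cs := if a == b then [:: Backward 1 0 (Unzig true (~~ a))]
  else [:: Forward 1 0 (Unzig false b)].
by case: a b @cs => [] [] cs; by_instructions cs.
Qed.

Lemma smooth_pass_min framed a o :
  wequiv framed [:: a] (smooth_all [:: a] [:: cup 1 o; xing 0 Double])
    (smooth_all [:: a] [:: cup 0 o; xing 1 Double]).
Proof.
pose cs := if a == o then [:: Backward 0 0 (Unzig false o)]
  else [:: Forward 0 0 (Unzig true o)].
by case: a o @cs => [] [] cs; by_instructions cs.
Qed.

(** A move without double points survives unchanged ([wequiv_plain]). There remain the exchange, the
    passage of a double point through an extremum, the slides across a double point and the vertex
    twist. *)
Lemma smooth_flat_move framed s s' l r : flat_move framed s l r ->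
  run s l = Some s' -> run s r = Some s' ->
  wequiv framed s (smooth_all s l) (smooth_all s r).
Proof.
have right_ctx t q u l1 r1 : run t l1 = Some u -> run t r1 = Some u ->
    wequiv framed t (smooth_all t l1) (smooth_all t r1) ->
    wequiv framed (t ++ q) (smooth_all (t ++ q) l1) (smooth_all (t ++ q) r1).
  move=> El Er; rewrite (smooth_all_right _ El) (smooth_all_right _ Er).
  exact: wequiv_right.
move=> m El Er; have := wequiv_plain m El Er.
case: m El Er => [{}l {}r [{}l {}r iso|rt o e uf|rt rt' o e fr|rt o|m nd|m k sl|m k sl|m k sl|o e es]|e].
- case: iso => [x y g|o|o|k|o k] El Er plain.
  + exact: smooth_exchange El.
  + exact: plain.
  + exact: plain.
  + case: k El Er plain => [e||] El Er plain; [exact: plain|exact: plain|].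
    case: s El {Er plain} => [|a [|b [|c q]]] // El.
    have {El}ea : c = ~~ a by move: El; rewrite /= /step /=; case: eqP => // ->; rewrite negbK.
    rewrite ea; apply: (right_ctx [:: a; b; ~~ a] q [:: b]);
      by rewrite /= ?/step /= ?negbK ?eqxx //; apply: smooth_pass_max.
  + case: k El Er plain => [e||] El Er plain; [exact: plain|exact: plain|].
    case: s El {Er plain} => [|a q] // _.
    by apply: (right_ctx [:: a] q [:: o; a; ~~ o]) => //; apply: smooth_pass_min.
- by move=> _ _; apply; case: rt.
- by move=> _ _; apply; case: rt; case: rt'.
- by move=> _ _; apply; case: rt.
- by move=> _ _; apply; case: m nd => [].
- have nd : m != Double by case: m sl.
  have [->|nk] := eqVneq k Double;
    last by move=> _ _; apply; case: m k {sl} nd nk => [e||] // [e'||].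
  case: s => [|a [|b [|c q]]] // _ _ _.
  by apply: (right_ctx [:: a; b; c] q [:: c; b; a]) => //; apply: smooth_slide1.
- have nd : m != Double by case: m sl.
  have [->|nk] := eqVneq k Double;
    last by move=> _ _; apply; case: m k {sl} nd nk => [e||] // [e'||].
  case: s => [|a [|b [|c q]]] // _ _ _.
  by apply: (right_ctx [:: a; b; c] q [:: c; b; a]) => //; apply: smooth_slide2.
- have nd : m != Double by case: m sl.
  have [->|nk] := eqVneq k Double;
    last by move=> _ _; apply; case: m k {sl} nd nk => [e||] // [e'||].
  case: s => [|a [|b [|c q]]] // _ _ _.
  by apply: (right_ctx [:: a; b; c] q [:: c; b; a]) => //; apply: smooth_slide3.
(* The strands are parallel, so the double point is smoothed to nothing and both sides become the
   same single crossing. *)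
- by rewrite es => _ _ _; rewrite /smooth_all /smooth_slice /smoothing /= eqxx; apply: wequiv_refl.
- by move=> _ _; apply.
Qed.

Lemma smooth_all_wstep framed st w w' s : run st w = Some s ->
  wstep framed st w w' -> wequiv framed st (smooth_all st w) (smooth_all st w').
Proof.
move=> Ew [u v p q t t' l r Eu El Er m ew ew'].
have Esl := run_shift p q El; have Esr := run_shift p q Er.
rewrite ew ew' !(smooth_all_cat _ Eu) !(smooth_all_cat _ Esl) !(smooth_all_cat _ Esr).
rewrite !(smooth_all_shift _ _ El) !(smooth_all_shift _ _ Er).
exact: (wequiv_ctx _ (run_smooth_all Eu) (smooth_flat_move m El Er)).
Qed.

Lemma smooth_all_wequiv framed st w w' s : run st w = Some s ->
  wequiv framed st w w' -> wequiv framed st (smooth_all st w) (smooth_all st w').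
Proof.
move=> Ew E; elim: E Ew => {w w'} [w w' H Ew|w _|w w' E IH Ew'|w1 w2 w3 E1 IH1 _ IH2 Ew].
- exact: smooth_all_wstep Ew H.
- exact: wequiv_refl.
- by apply: wequiv_sym; apply: IH; rewrite (wequiv_run E).
- by apply: (wequiv_trans (IH1 Ew)); apply: IH2; rewrite -(wequiv_run E1).
Qed.

Lemma well_formed_smooth_all long (D : diagram long) :
  well_formed long (smooth_all (ends long) (val D)).
Proof. by apply/eqP/run_smooth_all/eqP/(valP D). Qed.

Definition smooth_diagram long (D : diagram long) : diagram long :=
  Sub (smooth_all (ends long) (val D)) (well_formed_smooth_all D).

Lemma flat_smooth_diagram framed long (D D' : diagram long) :
  flat framed D = flat framed D' ->
  flat framed (smooth_diagram D) = flat framed (smooth_diagram D').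
Proof.
move=> /flat_eqP/flat_wequiv E; apply/flat_eqP/wequiv_flat.
exact: (smooth_all_wequiv (eqP (valP D)) E).
Qed.

(** Defined through a representative; [flat_smooth_diagram] makes the result independent of it. *)
Definition smooth_class framed long (c : flat_class framed long) : flat_class framed long :=
  flat framed (smooth_diagram (repr c)).

Lemma smooth_class_flat framed long (D : diagram long) :
  smooth_class (flat framed D) = flat framed (smooth_diagram D).
Proof. by apply: flat_smooth_diagram; rewrite /flat reprK. Qed.

Lemma has_double_cat u v : has_double (u ++ v) = has_double u || has_double v.
Proof. exact: has_cat. Qed.

Lemma run_take_drop long (D : diagram long) d : d < size (val D) ->
  exists s s', [/\ run (ends long) (take d (val D)) = Some s,
    step s (slice_at (val D) d) = Some s' &
    run s' (drop d.+1 (val D)) = Some (ends long)].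
Proof.
move=> lt; have := eqP (valP D).
rewrite -{1}(cat_take_drop d (val D)) (drop_nth (cap 0) lt) run_cat.
case E: (run _ _) => [s|] //; rewrite [obind _ _]/= -/(step _ _).
case Es: (step s _) => [s'|] // Ew.
by exists s, s'.
Qed.

Lemma smooth_glue_word long (D : diagram long) d :
  ~~ has_double (val D) -> is_classical (val D) d ->
  smooth_all (ends long) (glue_word (val D) d) = smooth_word long (val D) d.
Proof.
move=> nd cl; have lt := is_classical_size cl.
have [s [s' [Es Ex Ev]]] := run_take_drop lt.
have /andP[nd1 /norP[_ nd2]] : ~~ has_double (take d (val D)) &&
    ~~ has_double (slice_at (val D) d :: drop d.+1 (val D)).
  by rewrite -negb_or -has_double_cat -(drop_nth (cap 0) lt) cat_take_drop.
rewrite /glue_word /smooth_word /replace /strands_at Es /= (smooth_all_cat _ Es).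
rewrite smooth_all_id // /= smooth_all_id // /smooth_slice /smoothing /=.
by case: ifP.
Qed.

Lemma if_boolP (b : bool) (T : Type) (f : b -> T) (x : T) (h : b) :
  (if boolP b is AltTrue h' then f h' else x) = f h.
Proof.
by case: {-}_ / boolP f h => [h f h'|nh f h']; [rewrite (bool_irrelevance h h')|case: b h' nh f].
Qed.

Lemma val_glue long (D : diagram long) d : is_classical (val D) d ->
  val (glue D d) = glue_word (val D) d.
Proof. by move=> cl; rewrite /glue (if_boolP _ _ cl). Qed.

Lemma val_smooth long (D : diagram long) d : is_classical (val D) d ->
  val (smooth D d) = smooth_word long (val D) d.
Proof. by move=> cl; rewrite /smooth (if_boolP _ _ cl). Qed.

Lemma smooth_glue framed long (K : vknot long) d : is_classical (val (vknot_diagram K)) d ->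
  flat framed (smooth_diagram (glue K d)) = flat framed (smooth K d).
Proof.
move=> cl; congr flat; apply: val_inj; rewrite val_smooth //=.
by rewrite val_glue //; apply: smooth_glue_word => //; apply: vknot_nonsingular.
Qed.

(** * A split circle moves freely *)

Lemma circle_commute framed s w o s' : run s w = Some s' ->
  wequiv framed s ([:: cup 0 o; cap 0] ++ w) (w ++ [:: cup 0 o; cap 0]).
Proof.
have circ t : run t [:: cup 0 o; cap 0] = Some t.
  by case: t => [|a t]; rewrite /= /step /= negbK eqxx.
elim: w s => [|[i x] w IH] s; first by move=> _; apply: wequiv_refl.
rewrite run_cons; case Ex: (step s (i, x)) => [s1|] // Ew.
have Ex' : run s [:: (i, x)] = Some s1 by rewrite run_cons Ex.
apply: (@wequiv_trans _ _ _ ([:: (i, x)] ++ [:: cup 0 o; cap 0] ++ w)); last first.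
  exact: (wequiv_catl Ex' (IH _ Ew)).
(* A split circle is a stack with no strand below or above it, so each event of [w] can be exchanged
   with it. *)
apply: (@wequiv_catr framed s w [:: cup 0 o; cap 0; (i, x)] [:: (i, x); cup 0 o; cap 0]).
apply: (@exchange_below framed s 0 [:: Cup o; Cap] 0 i x s1) => //.
by rewrite (run_cat _ [:: cup 0 o; cap 0]) circ.
Qed.

(** The circle crosses the leftmost strand by a virtual second Reidemeister move. If [o] is false it
    arrives with the wrong rotation, which a detour through virtual kinks reverses. *)
Lemma circle_left framed o s : head true s = o -> s != [::] ->
  wequiv framed s [:: cup 1 o; cap 1] [:: cup 0 true; cap 0].
Proof.
case: s => //= a s -> _; apply: (wequiv_right s (s := [:: o])).
pose cs := if o then [:: Backward 1 0 (Cancel Virtual); Forward 2 0 (Cross_max Virtual);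
    Forward 0 0 (Cross_min true Virtual); Forward 1 1 (Cancel Virtual)]
  else [:: Backward 1 0 (Cancel Virtual); Forward 0 0 (Cross_min false Virtual);
    Forward 2 0 (Cross_max Virtual); Forward 1 1 (Cancel Virtual);
    Backward 1 0 (Unkink false false); Swap 0; Swap 3; Forward 1 1 (Unkink true false)].
by case: o @cs => cs; by_instructions cs.
Qed.

Lemma smooth_singular_kink framed long (K : vknot long) :
  flat framed (smooth_diagram (singular_kink K)) = flat framed (union_unknot K).
Proof.
case: K => -[w wf] conn nd; apply/flat_eqP/wequiv_flat; rewrite /= in conn nd *.
rewrite /singular_kink_word /union_unknot_word.
set h := if long then 0 else 1.
(* In the closed case connectedness makes [w] nonempty, and its first slice must be a minimum
   because nothing else fits on an empty line; so there is a strand to carry the kink. *)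
have [s [Es s0]] : exists s, run (ends long) (take h w) = Some s /\ s != [::].
  rewrite {}/h; case: long wf conn => wf conn; first by exists [:: true]; rewrite take0.
  case: w wf conn {nd} => // -[i x] w wf _ /=; rewrite take0.
  move: wf; rewrite /well_formed run_cons /=.
  by case: x => [o||k]; rewrite /step; case: i => [|i] //; exists [:: o; ~~ o].
rewrite Es [odflt _ _]/=; set o := head true s.
have [a [q es]] : exists a q, s = a :: q by case: s s0 {Es o} => // a q; exists a, q.
have Ek : run s (kink true o Double) = Some s.
  by rewrite /o es /= /step /= take0 drop0 /= negbK eqxx.
have /andP[nd1 nd2] : ~~ has_double (take h w) && ~~ has_double (drop h w).
  by rewrite -negb_or -has_double_cat cat_take_drop.
have Ev : run s (drop h w) = Some (ends long).
  by move: wf; rewrite /well_formed -{1}(cat_take_drop h w) run_cat Es => /eqP.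
rewrite (smooth_all_cat _ Es) (smooth_all_cat _ Ek).
rewrite (smooth_all_id _ nd1) (smooth_all_id _ nd2).
rewrite -[X in wequiv _ _ _ (X ++ _)](cat_take_drop h w).
(* The two strands of the kink are parallel at the double point, so smoothing leaves a circle to the
   right of the first strand. *)
have -> : smooth_all s (kink true o Double) = [:: cup 1 o; cap 1].
  by rewrite /o es; clear; case: a; case: q.
rewrite -catA; apply: (wequiv_catl Es).
apply: (wequiv_trans (wequiv_catr _ (circle_left framed erefl s0))).
exact: circle_commute Ev.
Qed.

(** * Two knots with the same smoothing invariant *)

Definition close_up (w : word) : word := [:: cup 0 true] ++ w ++ [:: cap 0].

(** The classical crossings are named by their slice positions 1, 3, 6 and 8. The parameter [e]
    changes 1 and 8 together, which keeps their signs opposite. *)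
Definition example_word (e : bool) : word :=
  [:: cup 1 true; xing 0 (Classical e); xing 1 Virtual; xing 1 (Classical true);
      xing 1 Virtual; xing 0 Virtual; xing 0 (Classical true); xing 0 Virtual;
      xing 0 (Classical e); cap 1].

Definition example_closed (long e : bool) : word :=
  if long then example_word e else close_up (example_word e).

Lemma example_well_formed long e : well_formed long (example_closed long e).
Proof. by case: long; case: e. Qed.

Lemma example_connected long e :
  num_closed_components long (example_closed long e) = if long then 0 else 1.
Proof. by case: long; case: e. Qed.

Lemma example_nonsingular long e : ~~ has_double (example_closed long e).
Proof. by case: long; case: e. Qed.

Definition example (long e : bool) : vknot long :=
  @VKnot long (exist _ (example_closed long e) (example_well_formed long e))
    (example_connected long e) (example_nonsingular long e).

(* Found by computer search. *)
Definition smoothing_path : seq instruction :=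
  [:: Backward 1 2 (Unzig false false); Swap 2; Swap 3; Swap 4; Swap 5; Swap
      6; Swap 7; Swap 8; Swap 9; Forward 1 1 (Cross_min false Virtual); Swap
      0; Swap 9; Swap 8; Swap 7; Swap 6; Swap 5; Swap 4; Swap 3; Forward 1 2
      (Unkink true true); Backward 1 0 (Cancel Virtual); Forward 0 0
      (Cross_min false Virtual); Backward 1 0 (Slide_third Virtual (Classical
      true)); Backward 2 0 (Slide_first Virtual Virtual); Forward 4 0 (Cancel
      Virtual); Forward 2 0 (Slide_first Virtual (Classical true)); Forward 3
      0 (Slide_first Virtual Virtual); Forward 4 0 (Slide_first Virtual
      (Classical true)); Backward 5 2 (Unzig false false); Swap 6; Swap 7;
      Swap 8; Swap 5; Forward 6 1 (Cross_min false Virtual); Forward 6 1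
      (Unkink false true); Forward 5 0 (Cross_max Virtual); Backward 1 1
      (Unzig false true); Swap 2; Forward 1 0 (Cross_min true (Classical
      true)); Swap 0; Forward 1 1 (Flip_kink false); Backward 1 1 (Cross_min
      true (Classical false)); Swap 0; Backward 1 0 (Cross_min true (Classical
      false)); Forward 1 0 (Flip_kink true); Backward 1 0 (Cross_min false
      (Classical false)); Swap 3; Swap 2; Swap 4; Swap 3; Swap 1; Swap 5; Swap
      4; Swap 2; Swap 6; Swap 5; Swap 3; Swap 7; Swap 6; Swap 4; Forward 5 1
      (Unzig false false); Backward 4 0 (Cancel Virtual); Forward 5 0
      (Slide_first Virtual (Classical true)); Backward 7 0 (Cross_max
      Virtual); Forward 6 0 (Cancel Virtual); Backward 0 0 (Cross_min true
      (Classical false)); Backward 4 2 (Unzig false false); Swap 5; Swap 6;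
      Swap 7; Swap 4; Forward 5 1 (Cross_min false (Classical true)); Backward
      5 1 (Flip_kink true); Forward 5 1 (Cross_min true (Classical true));
      Backward 7 3 (Cancel Virtual); Backward 8 2 (Cross_max Virtual); Swap 9;
      Forward 6 2 (Slide_third Virtual (Classical true)); Swap 8; Swap 5;
      Forward 6 1 (Unkink false false); Backward 3 0 (Slide_first Virtual
      (Classical true)); Forward 1 0 (Slide_third Virtual (Classical true));
      Backward 1 1 (Unzig true false); Swap 2; Backward 1 2 (Cross_min false
      Virtual); Swap 0; Forward 1 1 (Unkink false false); Backward 2 2 (Unkink
      true true); Swap 4; Swap 5; Swap 6; Swap 7; Swap 8; Swap 1; Swap 2; Swap
      0; Backward 1 1 (Cross_min false Virtual); Swap 8; Swap 7; Swap 6; Swap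
      5; Swap 4; Swap 3; Swap 2; Forward 1 2 (Unzig false false); Backward 1 0
      (Slide_third Virtual (Classical true)); Forward 3 0 (Slide_first Virtual
      (Classical true)); Backward 7 0 (Cancel Virtual); Forward 8 0 (Cross_max
      Virtual); Backward 6 0 (Slide_first Virtual (Classical true)); Backward
      5 0 (Slide_first Virtual Virtual); Forward 4 0 (Cancel Virtual);
      Backward 7 0 (Unkink false true); Backward 7 0 (Cross_min false
      Virtual); Swap 9; Swap 8; Forward 7 1 (Unzig false false); Backward 9 0
      (Unzig false true)].

Lemma wequiv_close_up framed w w' : wequiv framed [:: true] w w' ->
  wequiv framed [::] (close_up w) (close_up w').
Proof.
move=> E; have Eu : run [::] [:: cup 0 true] = Some ([::] ++ [:: true] ++ [:: false]) by [].
by have := wequiv_ctx [:: cap 0] Eu E; rewrite !shift0.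
Qed.

(** Closing up puts a minimum below the long knot, which moves every slice up by one. *)
Definition base (long : bool) (d : nat) : nat := if long then d else d.+1.

Lemma smooth_example framed long e :
  flat framed (smooth (example long e) (base long 1)) =
  flat framed (smooth (example long e) (base long 8)).
Proof.
(* The path joins the long tangles; closing up both ends gives the closed case, and the same path
   serves both values of [e] and both framings. *)
have E : wequiv framed [:: true] (smooth_word true (example_word e) 1)
    (smooth_word true (example_word e) 8).
  by case: e; by_instructions smoothing_path.
have cl d : d \in [:: 1; 8] -> is_classical (val (vknot_diagram (example long e))) (base long d).
  by rewrite !inE => /orP[] /eqP ->; case: long; case: e E.
apply/flat_eqP/wequiv_flat; rewrite !val_smooth ?cl //.
by case: long {cl}; case: e E => E //=; apply: (wequiv_close_up E).
Qed.

Lemma flat_shadow framed long (D D' : diagram long) :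
  shadow (val D) = shadow (val D') -> flat framed D = flat framed D'.
Proof.
by move=> E; apply/flat_eqP/wequiv_flat; apply: wequiv_shadow (eqP (valP D)) E.
Qed.

Definition example_classical (long : bool) : seq nat := map (base long) [:: 1; 3; 6; 8].

Lemma example_filter long e :
  [seq d <- iota 0 (size (example_closed long e)) | is_classical (example_closed long e) d]
  = example_classical long.
Proof. by case: long; case: e. Qed.

(** * The smoothing invariant as an additive image of the glueing invariant *)

Local Open Scope ring_scope.

HB.instance Definition _ (K : choiceType) (M : lmodType int) (f : K -> M) :=
  GRing.isAdditive.Build {freeg K} M (fglift f) (lift_is_additive f).

Lemma smoothing_of_glueing framed long (K : vknot long) :
  smoothing_invariant framed K =
    fglift (fun c => << smooth_class c >> : {freeg (flat_class framed long)})
      (glueing_invariant framed K).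
Proof.
rewrite /glueing_invariant raddf_sum /=; apply: eq_bigr => d cl.
rewrite raddfMz raddfB /= liftU scale1r smooth_class_flat smooth_glue //.
congr ((_ - _) *~ _); case: (framed); first by rewrite raddf0.
by rewrite liftU scale1r smooth_class_flat smooth_singular_kink.
Qed.

(** * A labelled state sum *)

(* Labels of an upward or downward strand ([ori]) of a diagram with one double
   point: the lobe it belongs to, and its Alexander numberings [lev] and
   [lobe / 2 + par] (modulo 2) with respect to the whole curve and to the lobe X.
   Passing a strand of the curve from left to right adds 1 to [lev], and passing a
   strand of X adds 1 to the second one; the double point counts as a crossing,
   and for half a crossing in the second one. *)
Record strand := Strand { ori : bool; lobe : bool; par : bool; lev : int }.

Definition dir (p : strand) : int := if ori p then 1 else -1.

Definition turn (p : strand) : strand := Strand (~~ ori p) (lobe p) (par p) (lev p).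

Definition relabel (p : strand) (c : bool) (d : int) : strand :=
  Strand (ori p) (lobe p) (par p (+) c) (lev p + d).

(* For the loop L cut off at a crossing of [p], from bottom left to top right, with
   [q], twice the number L.K is [gap p q], and L.X is odd iff [odd_pair p q] (the
   labels before and after the crossing being averaged). *)
Definition gap (p q : strand) : int := 2 * (lev p - lev q) + dir p + dir q.

Definition odd_pair (p q : strand) : bool :=
  par p (+) par q (+) (lobe p && ori p) (+) (lobe q && ~~ ori q).

Definition weight (p q : strand) : int :=
  if odd_pair p q then dir p * dir q * ((gap p q == 4)%:R - (gap p q == - 4)%:R)
  else 0.

Definition pass_right (p q : strand) : strand := relabel p (lobe q) (dir q).
Definition pass_left (q p : strand) : strand := relabel q (lobe p) (- dir p).

(* X and Y are the closed curves obtained by smoothing, and X.Y is 2 or -2. *)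
Definition admissible (p q : strand) : bool :=
  [&& (lobe p != lobe q) == (ori p == ori q), `|gap p q| == 4 & ~~ odd_pair p q].

Definition swap_lobe (p : strand) : strand :=
  Strand (ori p) (~~ lobe p) (par p) (lev p).

(** The parity correction is chosen so that, together with the change of lobe, [lobe / 2 + par]
    grows by [dir q / 2] modulo 2; [through_left] lowers it by [dir p / 2]. *)
Definition through_right (p q : strand) : strand :=
  swap_lobe (relabel p (lobe p (+) ~~ ori q) (dir q)).
Definition through_left (q p : strand) : strand :=
  swap_lobe (relabel q (lobe q (+) ori p) (- dir p)).

Definition cond := seq strand -> int -> Prop.

(* [sums w Q x k]: the strands below [w] carrying the labels [x], some labelling of
   [w] has labels [y] above [w] and weight [j], with [Q y (k + j)]. *)
Fixpoint sums (w : word) (Q : cond) (x : seq strand) (k : int) : Prop :=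
  if w is (i, e) :: w' then
    match e with
    | Cup o => (i <= size x)%N /\
        exists p, ori p = o /\ sums w' Q (take i x ++ [:: p, turn p & drop i x]) k
    | Cap =>
        if drop i x is [:: p, q & r] then q = turn p /\ sums w' Q (take i x ++ r) k
        else False
    | Xing c =>
        if drop i x is [:: p, q & r] then
          match c with
          | Classical _ =>
              sums w' Q (take i x ++ [:: pass_left q p, pass_right p q & r]) (k + weight p q)
          | Virtual => sums w' Q (take i x ++ [:: q, p & r]) k
          | Double => admissible p q /\
              sums w' Q (take i x ++ [:: through_left q p, through_right p q & r]) k
          end
        else False
    end
  else Q x k.

Lemma sums_cat u v Q x k : sums (u ++ v) Q x k = sums u (sums v Q) x k.
Proof.
elim: u x k => //= -[i [o||[e||]]] u IH x k.
- by congr (_ /\ _); congr ex; apply/funext => p; rewrite IH.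
- by case: (drop i x) => [|p [|q r]] //; rewrite IH.
- by case: (drop i x) => [|p [|q r]] //; rewrite IH.
- by case: (drop i x) => [|p [|q r]] //; rewrite IH.
- by case: (drop i x) => [|p [|q r]] //; rewrite IH.
Qed.

Lemma sums_shift a l Q x k :
  sums (shift (size a) l) Q (a ++ x) k = sums l (fun y => Q (a ++ y)) x k.
Proof.
elim: l x k => // -[i e] l IH x k; rewrite [shift _ _]/=.
have dropE : drop (size a + i) (a ++ x) = drop i x.
  by rewrite addnC -drop_drop drop_size_cat.
have takeE : take (size a + i) (a ++ x) = a ++ take i x.
  by rewrite takeD take_size_cat // drop_size_cat.
case: e => [o||[e||]] /=; rewrite dropE takeE ?size_cat ?leq_add2l.
- congr (_ /\ _); congr ex; apply/funext => p; congr (_ /\ _).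
  by rewrite -catA IH.
- by case: (drop i x) => [|p [|q r]] //; rewrite -catA IH.
- by case: (drop i x) => [|p [|q r]] //; rewrite -catA IH.
- by case: (drop i x) => [|p [|q r]] //; rewrite -catA IH.
- by case: (drop i x) => [|p [|q r]] //; rewrite -catA IH.
Qed.

Lemma sums_translate w Q x k c :
  sums w Q x (k + c) = sums w (fun y j => Q y (j + c)) x k.
Proof.
elim: w x k => //= -[i [o||[e||]]] w IH x k.
- by congr (_ /\ _); congr ex; apply/funext => p; rewrite IH.
- by case: (drop i x) => [|p [|q r]] //; rewrite IH.
- by case: (drop i x) => [|p [|q r]] //; rewrite addrAC IH.
- by case: (drop i x) => [|p [|q r]] //; rewrite IH.
- by case: (drop i x) => [|p [|q r]] //; rewrite IH.
Qed.

Lemma sums_exists (T : Type) w (Q : T -> cond) x k :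
  sums w (fun y j => exists t, Q t y j) x k = exists t, sums w (Q t) x k.
Proof.
elim: w x k => //= -[i [o||[e||]]] w IH x k.
- apply/propext; split.
    by move=> [le [p [op]]]; rewrite IH => -[t H]; exists t; split=> //; exists p.
  by move=> [t [le [p [op H]]]]; split=> //; exists p; split=> //; rewrite IH; exists t.
- case: (drop i x) => [|p [|q r]]; try by apply/propext; split=> // -[].
  by rewrite IH; apply/propext; split=> [[h [t H]]|[t [h H]]]; [exists t|split=> //; exists t].
- by case: (drop i x) => [|p [|q r]]; try by apply/propext; split=> // -[].
- by case: (drop i x) => [|p [|q r]]; try by apply/propext; split=> // -[].
- case: (drop i x) => [|p [|q r]]; try by apply/propext; split=> // -[].
  by rewrite IH; apply/propext; split=> [[h [t H]]|[t [h H]]]; [exists t|split=> //; exists t].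
Qed.

(** The orientations of the labels follow [run], so a continuation may assume them to be correct. *)
Lemma sums_ori w Q x k s : run (map ori x) w = Some s ->
  sums w Q x k = sums w (fun y j => map ori y = s /\ Q y j) x k.
Proof.
elim: w x k => [|[i e] w IH] x k.
  by case=> <- /=; apply/propext; split=> // -[].
rewrite run_cons; case: e => [o||c] /=; rewrite /step.
- rewrite size_map; case: leqP => // le; rewrite -map_take -map_drop => E.
  congr (_ /\ _); congr ex; apply/funext => p; apply/propext.
  by split=> -[op H]; split=> //; move: H; rewrite -IH //; rewrite map_cat /= op.
- rewrite -map_take -map_drop; case: (drop i x) => [|p [|q r]] //=; case: eqP => // _ E.
  by rewrite -IH // map_cat.
- rewrite -map_take -map_drop; case: (drop i x) => [|p [|q r]] //= E.
  by case: c => [e||]; rewrite -IH // map_cat.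
Qed.

(** The local rules as one relation, which lets [sums_exchange] treat all pairs of events at once:
    two independent choices of labels commute. *)
Inductive fires : event -> seq strand -> seq strand -> int -> Prop :=
| Fires_cup p : fires (Cup (ori p)) [::] [:: p; turn p] 0
| Fires_cap p : fires Cap [:: p; turn p] [::] 0
| Fires_classical e p q :
    fires (Xing (Classical e)) [:: p; q] [:: pass_left q p; pass_right p q] (weight p q)
| Fires_virtual p q : fires (Xing Virtual) [:: p; q] [:: q; p] 0
| Fires_double p q : admissible p q ->
    fires (Xing Double) [:: p; q] [:: through_left q p; through_right p q] 0.

Lemma fires_size x a b c : fires x a b c -> size b = top_strands x.
Proof. by case. Qed.

Lemma sums_event Q x a r k : size a = bottom_strands x ->
  sums [:: (0, x)] Q (a ++ r) k =
  exists b c (_ : fires x a b c), Q (b ++ r) (k + c).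
Proof.
case: x => [o||[e||]] /=.
- move=> /size0nil -> /=; apply/propext; rewrite take0 drop0; split.
    by move=> [_ [p [<- H]]]; exists [:: p; turn p], 0, (Fires_cup p); rewrite addr0.
  by move=> [b [c [H]]]; inversion H; subst => HQ; split=> //; exists p; rewrite addr0 in HQ.
- case: a => [|p [|q []]] //= _; apply/propext; split.
    by move=> [-> H]; exists [::], 0, (Fires_cap p); rewrite addr0.
  by move=> [b [c [H]]]; inversion H; subst; rewrite addr0.
- case: a => [|p [|q []]] //= _; apply/propext; split.
    by move=> H; exists [:: pass_left q p; pass_right p q], (weight p q), (Fires_classical e p q).
  by move=> [b [c [H]]]; inversion H; subst.
- case: a => [|p [|q []]] //= _; apply/propext; split.
    by move=> H; exists [:: q; p], 0, (Fires_virtual p q); rewrite addr0.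
  by move=> [b [c [H]]]; inversion H; subst; rewrite addr0.
- case: a => [|p [|q []]] //= _; apply/propext; split.
    by move=> [ad H]; exists [:: through_left q p; through_right p q], 0, (Fires_double ad); rewrite addr0.
  by move=> [b [c [H]]]; inversion H; subst; rewrite addr0.
Qed.

Lemma sums_exchange Q x y g a r k : size a = bottom_strands x ->
  sums [:: (0, x); (top_strands x + g, y)%N] Q (a ++ r) k =
  sums [:: (bottom_strands x + g, y)%N; (0, x)] Q (a ++ r) k.
Proof.
have one b P z j : sums [:: (size b + g, y)%N] P (b ++ z) j =
    sums [:: (g, y)] (fun t => P (b ++ t)) z j.
  exact: (sums_shift b [:: (g, y)]).
move=> sa; rewrite (sums_cat [:: (0, x)] [:: _]) (sums_cat [:: _] [:: (0, x)]).
rewrite sums_event // -sa one.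
have -> : (fun t => sums [:: (0, x)] Q (a ++ t)) = fun t j =>
    exists b c (_ : fires x a b c), Q (b ++ t) (j + c).
  by apply/funext => t; apply/funext => j; rewrite sums_event.
rewrite sums_exists; congr ex; apply/funext => b.
rewrite sums_exists; congr ex; apply/funext => c.
rewrite sums_exists; congr ex; apply/funext => f.
by rewrite -(fires_size f) one sums_translate.
Qed.

(** * Weights under the local moves *)

Lemma gap_relabel p q c c' d d' : gap (relabel p c d) (relabel q c' d') = gap p q + 2 * (d - d').
Proof.
by rewrite /gap -[dir (relabel p c d)]/(dir p) -[dir (relabel q c' d')]/(dir q) /=; lia.
Qed.

Lemma odd_pair_relabel p q c c' d d' :
  odd_pair (relabel p c d) (relabel q c' d') = odd_pair p q (+) (c (+) c').
Proof.
by case: p q c c' => [[] [] [] ?] [[] [] [] ?] [] [].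
Qed.

(** Passing the same third strand shifts both labels equally, and the weight only involves their
    difference. *)
Lemma weight_relabel2 p q c d : weight (relabel p c d) (relabel q c d) = weight p q.
Proof. by rewrite /weight odd_pair_relabel gap_relabel addbb addbF subrr mulr0 addr0. Qed.

Lemma admissible_relabel2 p q c d : admissible (relabel p c d) (relabel q c d) = admissible p q.
Proof. by rewrite /admissible odd_pair_relabel gap_relabel addbb addbF subrr mulr0 addr0. Qed.

Lemma odd_pair_relabel_l p q c d :
  odd_pair (relabel p c d) q = odd_pair p (relabel q c (- d)).
Proof. by case: p q c => [[] [] [] ?] [[] [] [] ?] []. Qed.

Lemma gap_relabel_l p q c d : gap (relabel p c d) q = gap p (relabel q c (- d)).
Proof.
by rewrite /gap -[dir (relabel p _ _)]/(dir p) -[dir (relabel q _ _)]/(dir q) /=; lia.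
Qed.

Lemma weight_relabel_l p q c d : weight (relabel p c d) q = weight p (relabel q c (- d)).
Proof. by rewrite /weight odd_pair_relabel_l gap_relabel_l. Qed.

Lemma admissible_relabel_l p q c d :
  admissible (relabel p c d) q = admissible p (relabel q c (- d)).
Proof. by rewrite /admissible odd_pair_relabel_l gap_relabel_l. Qed.

Lemma relabelC p c c' d d' :
  relabel (relabel p c d) c' d' = relabel (relabel p c' d') c d.
Proof. by rewrite /relabel /= addbAC addrAC. Qed.

Lemma relabelK p c d : relabel (relabel p c d) c (- d) = p.
Proof. by case: p => o l b a; rewrite /relabel /= addbK addrK. Qed.

(** The two crossings of a second Reidemeister move cancel: the gap changes sign, while the parity
    and the product of directions stay. *)
Lemma weight_back p q : weight p q + weight (pass_left q p) (pass_right p q) = 0.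
Proof.
rewrite /weight; have -> : odd_pair (pass_left q p) (pass_right p q) = odd_pair p q.
  by case: p q => [[] [] [] ?] [[] [] [] ?].
have -> : gap (pass_left q p) (pass_right p q) = - gap p q.
  rewrite /gap -[dir (pass_left q p)]/(dir q) -[dir (pass_right p q)]/(dir p) /=.
  by lia.
case: ifP => _; rewrite ?addr0 // -[dir (pass_left q p)]/(dir q).
rewrite -[dir (pass_right p q)]/(dir p) [dir q * dir p]mulrC -mulrDr eqr_oppLR eqr_opp.
by rewrite addrC addrA addrNK addrN mulr0.
Qed.

Lemma weight_eq p q p' q' : ori p = ori p' -> ori q = ori q' ->
  odd_pair p q = odd_pair p' q' -> gap p q = gap p' q' -> weight p q = weight p' q'.
Proof. by rewrite /weight /dir => -> -> -> ->. Qed.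

Lemma admissible_lobe p q : admissible p q ->
  (lobe p != lobe q) = (ori p == ori q).
Proof. by case/and3P => /eqP. Qed.

Lemma dir_relabel p c d : dir (relabel p c d) = dir p. Proof. by []. Qed.
Lemma dir_swap_lobe p : dir (swap_lobe p) = dir p. Proof. by []. Qed.

Lemma strand_ext p q : ori p = ori q -> lobe p = lobe q -> par p = par q ->
  lev p = lev q -> p = q.
Proof. by case: p q => [? ? ? ?] [? ? ? ?] /= -> -> -> ->. Qed.

Ltac by_bool :=
  rewrite /odd_pair /pass_left /pass_right /through_left /through_right /=;
  repeat match goal with
  | |- context [par ?p] => case: (par p)
  | |- context [lobe ?p] => case: (lobe p)
  | |- context [ori ?p] => case: (ori p)
  end; done.

Ltac by_level :=
  rewrite /gap /pass_left /pass_right /through_left /through_right;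
  rewrite ?(dir_swap_lobe, dir_relabel) /=; lia.

Ltac strand_eq := apply: strand_ext; [by []|by []|by_bool|by_level].

Lemma sums_slide p q r t Q k a b c a' b' c' :
  sums [:: xing 0 (Classical a); xing 1 (Classical b); xing 0 (Classical c)] Q
    [:: p, q, r & t] k =
  sums [:: xing 1 (Classical a'); xing 0 (Classical b'); xing 1 (Classical c')] Q
    [:: p, q, r & t] k.
Proof.
rewrite /=; congr Q.
  congr cons; first by rewrite /pass_left relabelC.
  congr cons; first by rewrite /pass_left /pass_right /= relabelC.
  by congr cons; rewrite /pass_left /pass_right /= relabelC.
rewrite weight_relabel_l !weight_relabel2.
rewrite -/(pass_left r q); lia.
Qed.

Lemma sums_slide1 p q r t Q k a b :
  sums [:: xing 0 (Classical a); xing 1 (Classical b); xing 0 Double] Q [:: p, q, r & t] k =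
  sums [:: xing 1 Double; xing 0 (Classical a); xing 1 (Classical b)] Q [:: p, q, r & t] k.
Proof.
rewrite /= admissible_relabel2; apply/propext.
(* Both sides ask for the same admissibility, and the final labels and weights need only agree under
   it. *)
suff eqQ : admissible q r -> Q [:: through_left (pass_left r (pass_right p q)) (pass_left q p),
    through_right (pass_left q p) (pass_left r (pass_right p q)),
    pass_right (pass_right p q) r & t] (k + weight p q + weight (pass_right p q) r) =
  Q [:: pass_left (through_left r q) p,
    pass_left (through_right q r) (pass_right p (through_left r q)),
    pass_right (pass_right p (through_left r q)) (through_right q r) & t]
   (k + weight p (through_left r q) +
    weight (pass_right p (through_left r q)) (through_right q r)).
  by split=> -[ad H]; split=> //; move: H; rewrite (eqQ ad).
(* The strand crossed by the sliding arc has another lobe beyond the double point; the parities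
   agree because [h] ties the lobes to the orientations. *)
move=> ad; have h := admissible_lobe ad; congr Q.
  congr cons; first by strand_eq.
  congr cons; first by strand_eq.
  by congr cons; strand_eq.
have -> : weight (pass_right p (through_left r q)) (through_right q r) = weight p q.
  by apply: weight_eq => //; [move: h; by_bool|by_level].
have -> : weight (pass_right p q) r = weight p (through_left r q).
  by apply: weight_eq => //; [move: h; by_bool|by_level].
by rewrite addrAC.
Qed.

Lemma sums_slide2 p q r t Q k a b c d :
  sums [:: xing 0 (Classical a); xing 1 Double; xing 0 (Classical b)] Q [:: p, q, r & t] k =
  sums [:: xing 1 (Classical c); xing 0 Double; xing 1 (Classical d)] Q [:: p, q, r & t] k.
Proof.
rewrite /= admissible_relabel_l; apply/propext.
suff eqQ : admissible p (pass_left r q) ->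
  Q [:: pass_left (through_left r (pass_right p q)) (pass_left q p),
    pass_right (pass_left q p) (through_left r (pass_right p q)),
    through_right (pass_right p q) r & t]
    (k + weight p q + weight (pass_left q p) (through_left r (pass_right p q))) =
  Q [:: through_left (pass_left r q) p,
    pass_left (pass_right q r) (through_right p (pass_left r q)),
    pass_right (through_right p (pass_left r q)) (pass_right q r) & t]
   (k + weight q r + weight (through_right p (pass_left r q)) (pass_right q r)).
  by split=> -[ad H]; split=> //; move: H; rewrite (eqQ ad).
move=> /admissible_lobe /= h; congr Q.
  congr cons; first by strand_eq.
  congr cons; first by strand_eq.
  by congr cons; strand_eq.
have -> : weight (through_right p (pass_left r q)) (pass_right q r) = weight p q.
  by apply: weight_eq => //; [move: h; by_bool|by_level].
have -> : weight (pass_left q p) (through_left r (pass_right p q)) = weight q r.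
  by apply: weight_eq => //; [move: h; by_bool|by_level].
by rewrite addrAC.
Qed.

Lemma sums_slide3 p q r t Q k a b :
  sums [:: xing 0 Double; xing 1 (Classical a); xing 0 (Classical b)] Q [:: p, q, r & t] k =
  sums [:: xing 1 (Classical a); xing 0 (Classical b); xing 1 Double] Q [:: p, q, r & t] k.
Proof.
rewrite /= admissible_relabel2; apply/propext.
suff eqQ : admissible p q ->
  Q [:: pass_left (pass_left r (through_right p q)) (through_left q p),
    pass_right (through_left q p) (pass_left r (through_right p q)),
    pass_right (through_right p q) r & t]
    (k + weight (through_right p q) r +
     weight (through_left q p) (pass_left r (through_right p q))) =
  Q [:: pass_left (pass_left r q) p,
    through_left (pass_right q r) (pass_right p (pass_left r q)),
    through_right (pass_right p (pass_left r q)) (pass_right q r) & t]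
   (k + weight q r + weight p (pass_left r q)).
  by split=> -[ad H]; split=> //; move: H; rewrite (eqQ ad).
move=> /admissible_lobe /= h; congr Q.
  congr cons; first by strand_eq.
  congr cons; first by strand_eq.
  by congr cons; strand_eq.
have -> : weight (through_right p q) r = weight p (pass_left r q).
  by apply: weight_eq => //; [move: h; by_bool|by_level].
have -> : weight (through_left q p) (pass_left r (through_right p q)) = weight q r.
  by apply: weight_eq => //; [move: h; by_bool|by_level].
by rewrite addrAC.
Qed.

Lemma turnK : involutive turn.
Proof. by case=> o l b a; rewrite /turn /= negbK. Qed.

Lemma dir_turn p : dir (turn p) = - dir p.
Proof. by rewrite /dir /=; case: (ori p). Qed.

Lemma relabelNK p c d : relabel (relabel p c (- d)) c d = p.
Proof. by rewrite -{2}[d]opprK relabelK. Qed.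

Lemma sums_zigzag_right p o t Q k : o = ~~ ori p ->
  sums [:: cup 1 o; cap 0] Q (p :: t) k = Q (p :: t) k.
Proof.
move=> ->; rewrite /= take0 drop0; apply/propext; split.
  by move=> [_ [q [oq [-> H]]]]; rewrite turnK in H.
by move=> H; split=> //; exists (turn p); rewrite turnK.
Qed.

Lemma sums_zigzag_left p o t Q k : o = ori p ->
  sums [:: cup 0 o; cap 1] Q (p :: t) k = Q (p :: t) k.
Proof.
move=> ->; rewrite /=; apply/propext; split.
  by move=> [_ [q [oq [-> H]]]]; rewrite turnK.
by move=> H; split=> //; exists p; rewrite turnK.
Qed.

Lemma weight_self p c : weight p (relabel p c (dir p)) = 0.
Proof.
rewrite /weight /gap dir_relabel /=.
have -> : 2 * (lev p - (lev p + dir p)) + dir p + dir p = 0 by lia.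
by case: ifP; rewrite // mulr0.
Qed.

(** The maximum closing the loop forces the label of the loop, and with that label a classical kink
    crossing has gap 0, hence weight 0. *)
Lemma sums_kink rt p o c t Q k : c != Double -> o = ori p ->
  sums (kink rt o c) Q (p :: t) k = Q (p :: t) k.
Proof.
move=> nd ->; apply/propext; case: c nd => [e||] // _; case: rt; rewrite /= ?take0 ?drop0.
- split=> [[_ [q [oq [eq H]]]]|H].
    have lq : lobe q = lobe p by have := congr1 lobe eq.
    have eq' : q = relabel p (lobe p) (dir p).
      by rewrite -(turnK q) eq turnK /pass_right lq /dir oq.
    by move: H; rewrite eq' /pass_left relabelK weight_self addr0.
  split=> //; exists (relabel p (lobe p) (dir p)); split=> //.
  by rewrite /= /pass_left /pass_right dir_relabel relabelK weight_self addr0.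
- split=> [[_ [q [oq [eq H]]]]|H].
    have lq : lobe q = lobe p by have := congr1 lobe eq.
    have eq' : turn q = relabel p (lobe p) (- dir p).
      have dq : dir q = - dir p by rewrite /dir oq; case: (ori p).
      by rewrite -eq /pass_left dir_turn /= lq dq !opprK.
    move: H; rewrite eq' /pass_right relabelNK weight_relabel_l opprK.
    by rewrite weight_self addr0.
  split=> //; exists (turn (relabel p (lobe p) (- dir p))); split=> //.
  rewrite turnK /pass_left /pass_right dir_relabel relabelNK weight_relabel_l opprK.
  by rewrite weight_self addr0.
- split=> [[_ [q [oq [eq H]]]]|H]; first by rewrite -(turnK p) -eq turnK.
  by split=> //; exists p.
- split=> [[_ [q [oq [eq H]]]]|H]; first by rewrite eq.
  by split=> //; exists (turn p); rewrite turnK.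
Qed.

Lemma sums_pair p q m t Q k : m != Double ->
  sums [:: xing 0 m; xing 0 (flip m)] Q [:: p, q & t] k = Q [:: p, q & t] k.
Proof.
case: m => [e||] //= _; rewrite -addrA weight_back addr0 /pass_left /pass_right.
by rewrite !dir_relabel /= relabelK relabelNK.
Qed.

(** For a crossing carried to the other leg of a maximum: the gap and the product of directions both
    change sign. *)
Lemma weight_turn p q : weight q (relabel (turn p) (lobe q) (dir q)) = weight p q.
Proof.
rewrite /weight dir_relabel dir_turn.
have -> : odd_pair q (relabel (turn p) (lobe q) (dir q)) = odd_pair p q by by_bool.
have -> : gap q (relabel (turn p) (lobe q) (dir q)) = - gap p q.
  by rewrite /gap dir_relabel dir_turn /=; lia.
by case: ifP => // _; rewrite !eqr_oppLR opprK mulrN mulNr -mulrN opprB [dir q * _]mulrC.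
Qed.

Lemma admissible_turn p q : admissible q (turn (through_right p q)) = admissible p q.
Proof.
rewrite /admissible.
have -> : gap q (turn (through_right p q)) = - gap p q.
  by rewrite /gap dir_turn /through_right dir_swap_lobe dir_relabel /=; lia.
rewrite Num.Theory.normrN.
have -> : (lobe q != lobe (turn (through_right p q))) ==
    (ori q == ori (turn (through_right p q))) = ((lobe p != lobe q) == (ori p == ori q)).
  by by_bool.
by case: eqP => //= h; congr (_ && ~~ _); move: h; by_bool.
Qed.

Lemma through_turnK p q : through_left (turn (through_right p q)) q = turn p.
Proof.
by apply: strand_ext; [|rewrite /= negbK| by_bool| rewrite /= addrK].
Qed.

Lemma turn_throughK r q : turn (through_right (turn (through_left r q)) q) = r.
Proof.
by apply: strand_ext; [rewrite /= !negbK|rewrite /= negbK| by_bool| rewrite /= addrNK].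
Qed.

Lemma through_turn p q : through_right q (turn (through_right p q)) = through_left q p.
Proof.
apply: strand_ext => //; first by by_bool.
by rewrite /= dir_turn.
Qed.

Lemma sums_pass_max p q r c t Q k :
  sums [:: xing 0 c; cap 1] Q [:: p, q, r & t] k =
  sums [:: xing 1 (flip c); cap 0] Q [:: p, q, r & t] k.
Proof.
have e1 : turn (pass_right p q) = relabel (turn p) (lobe q) (dir q) by [].
have e2 : pass_right q (relabel (turn p) (lobe q) (dir q)) = pass_left q p.
  by rewrite /pass_right dir_relabel dir_turn.
apply/propext; case: c => [e||]; rewrite /=.
- split=> -[er H].
    rewrite er e1 weight_turn e2; split=> //; exact: relabelK.
  have er' : r = relabel (turn p) (lobe q) (dir q) by rewrite -er /pass_left relabelNK.
  by move: H; rewrite er' weight_turn e2 e1.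
- by split=> -[-> H]; rewrite ?turnK.
- split=> -[ad [er H]].
    by rewrite er admissible_turn through_turnK through_turn.
  have er' : r = turn (through_right p q) by rewrite -(turnK p) -er turn_throughK.
  by move: ad H; rewrite er' admissible_turn through_turn.
Qed.

Lemma sums_pass_min p o c t Q k :
  sums [:: cup 1 o; xing 0 c] Q (p :: t) k =
  sums [:: cup 0 o; xing 1 (flip c)] Q (p :: t) k.
Proof.
apply/propext; case: c => [e||]; rewrite /= ?take0 ?drop0.
- have e1 u : turn u = pass_right (turn (pass_left u p)) p.
    by rewrite -[turn (pass_left u p)]/(relabel (turn u) (lobe p) (- dir p)) /pass_right relabelNK.
  have e2 u : pass_left p (turn (pass_left u p)) = pass_right p u.
    by rewrite /pass_left dir_turn dir_relabel opprK.
  have e3 u : weight (turn (pass_left u p)) p = weight p u.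
    rewrite -weight_turn -[turn (turn _)]/(turn (turn (pass_left u p))) turnK.
    by rewrite /pass_left relabelNK.
  split=> -[_ [u [<- H]]]; split=> //.
    by exists (pass_left u p); split=> //; rewrite e2 e3 -e1.
  exists (pass_right u p); split=> //.
  have eu : pass_left (pass_right u p) p = u by rewrite /pass_left /pass_right relabelK.
  by rewrite /= -e2 -e3 [turn (pass_right _ _)]e1 !eu.
- by split=> -[_ [u [<- H]]]; split=> //; exists u.
- have e1 u : turn u = through_right (turn (through_left u p)) p.
    by rewrite -{1}(turn_throughK u p) turnK.
  have e2 u : through_left p (turn (through_left u p)) = through_right p u.
    by apply: strand_ext => //; rewrite /= dir_turn opprK.
  have e3 u : admissible (turn (through_left u p)) p = admissible p u.
    by rewrite -admissible_turn turn_throughK.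
  split=> -[_ [u [<- [ad H]]]]; split=> //.
    by exists (through_left u p); split=> //; rewrite e2 e3 -e1.
  have eu : through_left (turn (through_right (turn u) p)) p = u.
    by rewrite through_turnK turnK.
  exists (turn (through_right (turn u) p)); split; first by rewrite /= negbK.
  by rewrite /= -e2 -e3 [turn (turn _)]e1 !eu.
Qed.

(** The loop cut off at the crossing is a lobe. Admissibility makes its parity even before the
    double point, and for parallel strands it stays even after it, so the crossing weighs 0 in both
    orders. *)
Lemma sums_twist p q a b t Q k : ori p = ori q ->
  sums [:: xing 0 Double; xing 0 (Classical a)] Q [:: p, q & t] k =
  sums [:: xing 0 (Classical b); xing 0 Double] Q [:: p, q & t] k.
Proof.
move=> o; rewrite /=; apply/propext.
have ead : admissible (pass_left q p) (pass_right p q) = admissible p q.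
  rewrite /admissible; have -> : odd_pair (pass_left q p) (pass_right p q) = odd_pair p q.
    by by_bool.
  have -> : gap (pass_left q p) (pass_right p q) = - gap p q.
    by rewrite /gap -[dir (pass_left q p)]/(dir q) -[dir (pass_right p q)]/(dir p) /=; lia.
  by rewrite Num.Theory.normrN /= o [lobe q == _]eq_sym.
have w0 x y : ~~ odd_pair x y -> weight x y = 0 by rewrite /weight => /negbTE ->.
rewrite ead.
suff eqQ : admissible p q ->
  Q [:: pass_left (through_right p q) (through_left q p),
    pass_right (through_left q p) (through_right p q) & t]
    (k + weight (through_left q p) (through_right p q)) =
  Q [:: through_left (pass_right p q) (pass_left q p),
    through_right (pass_left q p) (pass_right p q) & t] (k + weight p q).
  by split=> -[ad H]; split=> //; move: H; rewrite (eqQ ad).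
move=> ad; have /and3P[h _ np] := ad; rewrite (w0 _ _ np) w0; last first.
  by move: (admissible_lobe ad) np o; clear ad h; by_bool.
have dq : dir q = dir p by rewrite /dir o.
congr Q; congr cons; [|congr cons].
- by apply: strand_ext => //; by_bool.
- by apply: strand_ext => //; by_bool.
Qed.

(** * Invariance of the state sum *)

Lemma run_kink rt o c a s s' : run (a :: s) (kink rt o c) = Some s' -> o = a.
Proof.
by case: rt; case: o; case: a => //; case: s; rewrite /= /step.
Qed.

Lemma run_zigzag_right o a s s' :
  run (a :: s) [:: cup 1 o; cap 0] = Some s' -> o = ~~ a.
Proof. by case: o; case: a => //; case: s; rewrite /= /step. Qed.

Lemma run_zigzag_left o a s s' :
  run (a :: s) [:: cup 0 o; cap 1] = Some s' -> o = a.
Proof. by case: o; case: a => //; case: s; rewrite /= /step. Qed.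

Lemma sums_move framed s l r x s' q Q k : move framed s l r ->
  map ori x = s ++ q -> run (map ori x) l = Some s' -> sums l Q x k = sums r Q x k.
Proof.
case=> [{}l {}r [e f g|o|o|c|o c]|rt o e uf|rt rt' o e fr|rt o|m nd|m c sl|m c sl|m c sl|o e ->] ex E.
- have le : (bottom_strands e <= size x)%N.
    rewrite -(size_map ori); move: E; rewrite run_cons.
    by case E: (step _ _) => [s1|] // _; have := step_size E.
  rewrite -(cat_take_drop (bottom_strands e) x).
  by apply: sums_exchange; rewrite size_takel.
- by case: x {ex} E => [|p t] // /run_zigzag_right; apply: sums_zigzag_right.
- by case: x {ex} E => [|p t] // /run_zigzag_left; apply: sums_zigzag_left.
- by case: x {ex} E => [|p [|p' [|p'' t]]] // _; apply: sums_pass_max.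
- by case: x {ex} E => [|p t] // _; apply: sums_pass_min.
- case: x {ex} E => [|p t]; first by case: rt.
  by move=> /run_kink ->; apply: sums_kink.
- case: x {ex} E => [|p t]; first by case: rt.
  rewrite run_cat; case E: (run _ _) => [s1|] // _.
  rewrite sums_cat (run_kink E) sums_kink //.
  by apply: sums_kink.
- case: x {ex} E => [|p t]; first by case: rt.
  by move=> /run_kink ->; apply: sums_kink.
- by case: x {ex} E => [|p [|p' t]] // _; apply: sums_pair.
- case: x {ex} E => [|p [|p' [|p'' t]]] // _.
  case: m c sl => [a||] // [b||] // _; [exact: sums_slide|exact: sums_slide1|by []..].
- case: x {ex} E => [|p [|p' [|p'' t]]] // _.
  case: m c sl => [a||] // [b||] // _; [exact: sums_slide|exact: sums_slide2|by []..].
- case: x {ex} E => [|p [|p' [|p'' t]]] // _.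
  case: m c sl => [a||] // [b||] // _; [exact: sums_slide|exact: sums_slide3|by []..].
- case: x ex {E} => [|p [|p' t]] //= [ep ep' _].
  have epp : ori p = ori p' by rewrite ep ep'.
  exact: (sums_twist e e t Q k epp).
Qed.

Lemma sums_wstep framed st w w' Q x k : map ori x = st ->
  wstep framed st w w' -> sums w Q x k = sums w' Q x k.
Proof.
move=> ex [u v p q s s' l r Eu El Er m -> ->].
(* A move only preserves the sum for labels with the orientations it requires; [sums_ori] restricts
   the labels at its height to those. *)
have Eo Q' := @sums_ori u Q' x k _ (etrans (congr1 (run^~ u) ex) Eu).
rewrite !sums_cat [LHS]Eo [RHS]Eo.
congr sums; apply/funext => y; apply/funext => j.
apply/propext; suff eqQ : map ori y = p ++ s ++ q ->
    sums (shift (size p) l ++ v) Q y j = sums (shift (size p) r ++ v) Q y j.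
  by split=> -[ey H]; split=> //; move: H; rewrite (eqQ ey).
rewrite !sums_cat => ey; have sp : size (take (size p) y) = size p.
  by apply: size_takel; rewrite -(size_map ori) ey size_cat leq_addr.
rewrite -(cat_take_drop (size p) y) -{1 4}sp !sums_shift.
have ed : map ori (drop (size p) y) = s ++ q by rewrite map_drop ey drop_size_cat.
have El' := run_shift [::] q El; rewrite shift0 /= in El'.
case: m El El' Er => [{}l {}r m|e] El El' Er.
  by apply: (sums_move _ _ m ed); rewrite ed; apply: El'.
(* A crossing change is invisible, since [sums] ignores which strand is over. *)
by rewrite /=; case: (drop (size p) y).
Qed.

Lemma sums_wequiv framed st w w' Q x k : map ori x = st ->
  wequiv framed st w w' -> sums w Q x k = sums w' Q x k.
Proof.
move=> ex; elim=> {w w'} [w w' H|//|w w' _ -> //|w1 w2 w3 _ -> _ -> //].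
exact: sums_wstep H.
Qed.

(** * Evaluation on the two knots *)

Lemma sum_example (V : zmodType) long e (F : nat -> V) :
  \sum_(d < size (val (vknot_diagram (example long e))) |
        is_classical (val (vknot_diagram (example long e))) d)
    F d *~ sgn long (val (vknot_diagram (example long e))) d =
  (F (base long 1) - F (base long 8)) *~ (if e then 1 else -1) +
  (F (base long 3) *~ sgn long (example_closed long true) (base long 3) +
   F (base long 6) *~ sgn long (example_closed long true) (base long 6)).
Proof.
rewrite -(big_mkord (is_classical (example_closed long e))
  (fun d => F d *~ sgn long (example_closed long e) d)).
rewrite /index_iota subn0 -big_filter example_filter /example_classical.
rewrite !big_cons big_nil addr0 /=.
have -> : sgn long (example_closed long e) (base long 1) = if e then 1 else -1.
  by case: long; case: e.
have -> : sgn long (example_closed long e) (base long 8) = if e then -1 else 1.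
  by case: long; case: e.
have -> : sgn long (example_closed long e) (base long 3) =
    sgn long (example_closed long true) (base long 3) by case: long; case: e.
have -> : sgn long (example_closed long e) (base long 6) =
    sgn long (example_closed long true) (base long 6) by case: long; case: e.
case: e; rewrite ?mulr1z ?mulrN1z ?opprB; last rewrite [_ - F _]addrC.
  by rewrite -[RHS]addrA; congr (_ + _); rewrite addrA addrC.
by rewrite -[RHS]addrA; congr (_ + _); rewrite addrA addrC.
Qed.

Lemma smoothing_example framed long :
  smoothing_invariant framed (example long true) =
  smoothing_invariant framed (example long false).
Proof.
have sh (D D' : diagram long) : shadow (val D) = shadow (val D') ->
    flat framed D = flat framed D' := @flat_shadow framed long D D'.
rewrite /smoothing_invariant
  (sum_example _ _ (fun d => << flat framed (smooth (example long true) d) >>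
     - (if framed then 0 else << flat framed (union_unknot (example long true)) >>)))
  (sum_example _ _ (fun d => << flat framed (smooth (example long false) d) >>
     - (if framed then 0 else << flat framed (union_unknot (example long false)) >>))).
(* The terms of crossings 1 and 8 cancel; those of 3 and 6 and the unknot term only depend on
   shadows, which [e] does not affect. *)
rewrite !smooth_example !subrr !mul0rz !add0r.
have -> : flat framed (union_unknot (example long false)) =
    flat framed (union_unknot (example long true)) by apply: sh; case: long.
have sm d : d \in [:: 3; 6]%N -> flat framed (smooth (example long false) (base long d)) =
    flat framed (smooth (example long true) (base long d)).
  rewrite !inE => /orP[] /eqP ->; apply: sh; rewrite !val_smooth; by case: long.
by rewrite !sm.
Qed.

(** The total weight -1 is attained when crossing 1 is glued, and by no labelling when crossing 8
    is. *)
Definition weighs (w : word) : Prop := sums w (fun _ k => k = -1) [::] 0.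

Definition tie (long : bool) (w : word) : word := if long then close_up w else w.

Lemma weighs_flat framed long (D D' : diagram long) :
  flat framed D = flat framed D' -> weighs (tie long (val D)) = weighs (tie long (val D')).
Proof.
move=> /flat_eqP/flat_wequiv E; apply: (@sums_wequiv framed [::]) => //.
by case: long D D' E => D D' E //; apply: wequiv_close_up.
Qed.

Lemma weighs_glue1 : weighs (close_up (glue_word (example_word true) 1)).
Proof.
(* The first label is a normalisation. The second lies on the other lobe, as the strands at the
   double point are parallel, and its level -1 makes the gap 4. *)
rewrite /weighs /=; split=> //; exists (Strand true false false 0); split=> //.
by split=> //; exists (Strand true true false (-1)).
Qed.

Lemma weighs_glue8 : ~ weighs (close_up (glue_word (example_word true) 8)).
Proof.
rewrite /weighs /=.
move=> [_ [p [op [_ [q [oq [ad [E1 [E2]]]]]]]]].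
have := congr1 lobe E1; have := congr1 par E1; have := congr1 par E2.
have := congr1 lev E1; have := congr1 lev E2.
rewrite /weight.
(* [o1] and [o3] are the parities at crossings 1 and 6. The equations imposed by the two maxima make
   both even, so only crossing 3 can count; its gap is -4 and its strands are antiparallel, so the
   total is 0 or 1. *)
set o1 := odd_pair p q; set o3 := odd_pair (pass_right (turn q) _) _.
move=> v2 v1 b2 b1 l1.
have -> : o1 = false by rewrite {}/o1; move: b2 b1 l1 op oq; clear; by_bool.
have -> : o3 = false by rewrite {}/o3; move: b2 b1 l1 op oq; clear; by_bool.
have ev : lev q = lev p - 1.
  by clear - v1 v2 op oq; move: v1 v2; rewrite /= /dir /= op oq /=; lia.
have -> : gap (turn q) (pass_right p q) = - 4.
  by clear - ev op oq; rewrite /gap /= /dir /= op oq ev /=; lia.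
by rewrite /dir /= op oq; case: ifP.
Qed.

(** Integer valued, so that it extends additively to the free abelian group and can be applied to
    values of the glueing invariant. *)
Definition indicator framed long (c : flat_class framed long) : int^o :=
  if `[< weighs (tie long (val (repr c))) >] then 1 else 0.

Lemma indicator_flat framed long (D : diagram long) :
  indicator (flat framed D) = if `[< weighs (tie long (val D)) >] then 1 else 0.
Proof.
rewrite /indicator (@weighs_flat framed long (repr (flat framed D)) D) //.
by rewrite /flat reprK.
Qed.

Lemma weighs_example long :
  weighs (tie long (glue_word (example_closed long true) (base long 1))) /\
  ~ weighs (tie long (glue_word (example_closed long true) (base long 8))).
Proof.
have glue_close_up d : d \in [:: 1; 8]%N ->
    glue_word (example_closed false true) d.+1 = close_up (glue_word (example_word true) d).
  by rewrite !inE => /orP[] /eqP ->.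
case: long; first exact: conj weighs_glue1 weighs_glue8.
by rewrite /base /tie !glue_close_up //; apply: conj weighs_glue1 weighs_glue8.
Qed.

Lemma glueing_example framed long :
  glueing_invariant framed (example long true) <>
  glueing_invariant framed (example long false).
Proof.
have sh (D D' : diagram long) : shadow (val D) = shadow (val D') ->
    flat framed D = flat framed D' := @flat_shadow framed long D D'.
rewrite /glueing_invariant
  (sum_example _ _ (fun d => << flat framed (glue (example long true) d) >>
     - (if framed then 0 else << flat framed (singular_kink (example long true)) >>)))
  (sum_example _ _ (fun d => << flat framed (glue (example long false) d) >>
     - (if framed then 0 else << flat framed (singular_kink (example long false)) >>))).
have -> : flat framed (singular_kink (example long false)) =
    flat framed (singular_kink (example long true)) by apply: sh; case: long.
have gl d : d \in [:: 1; 3; 6; 8]%N -> flat framed (glue (example long false) (base long d)) =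
    flat framed (glue (example long true) (base long d)).
  rewrite !inE; case/or4P => /eqP ->; apply: sh; rewrite !val_glue; by case: long.
rewrite !gl // => /addIr; rewrite mulr1z mulrN1z !opprB !addrA !subrK.
(* Equality of the invariants has become equality of the difference of glueings 1 and 8 with its own
   negative; the indicator turns it into 1 = -1. *)
move=> /(congr1 (fglift (@indicator framed long))); rewrite !raddfB /= !liftU !scale1r.
have cl d : d \in [:: 1; 8]%N ->
    is_classical (val (vknot_diagram (example long true))) (base long d).
  by rewrite !inE => /orP[] /eqP ->; case: (long).
rewrite !indicator_flat !val_glue ?cl //.
by have [/asboolT-> /asboolF->] := weighs_example long.
Qed.

Theorem theorem17 (framed long : bool) :
  (forall K K' : vknot long,
     glueing_invariant framed K = glueing_invariant framed K' ->
     smoothing_invariant framed K = smoothing_invariant framed K') /\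
  (exists K1 K2 : vknot long,
     smoothing_invariant framed K1 = smoothing_invariant framed K2 /\
     glueing_invariant framed K1 <> glueing_invariant framed K2).
Proof.
split=> [K K' E|]; first by rewrite !smoothing_of_glueing E.
exists (example long true), (example long false).
by split; [apply: smoothing_example|apply: glueing_example].
Qed.
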